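(* Along any geodesic of the metric $\bar{\mathcal{G}}$ on $\mathrm{Vol}(M)$, i.e. along any solution $(\varrho(t),\theta(t))$, $\varrho=\rho\mu$, of $$\dot\rho=-\operatorname{div}(\rho\nabla\theta)+\xi\rho,\qquad \dot\theta=-\frac12|\nabla\theta|^2-\xi\theta+\frac{\xi^2}{2},\qquad \xi=\frac1m\int_M\theta\varrho,$$ the total volume $m:=\int_M\varrho$ evolves with constant acceleration that depends only on the energy level of the initial conditions, that is, only on the value at the initial conditions of the Hamiltonian $$H(\varrho,\theta)=\frac12\int_M|\nabla\theta|^2\varrho+\frac{1}{2m}\left(\int_M\theta\varrho\right)^2.$$
   Context: $M$ is an $n$-dimensional Riemannian manifold with volume form $\mu$ of total volume $\int_M\mu=1$ (for most applications one can think of a compact $M$, but the case $M=\mathbb{R}^n$ with Gaussian densities is also kept in mind). $\mathrm{Vol}(M)$ is the space of all smooth (un-normalized) volume forms on $M$ of finite total volume, regarded as positive densities $\varrho=\rho\mu$ with $\rho>0$; $\theta$ is a smooth real function on $M$. $\operatorname{div}$ is the divergence with respect to $\mu$; $\nabla$ and $|\cdot|$ refer to the Riemannian metric of $M$. The metric $\bar{\mathcal{G}}$ on $\mathrm{Vol}(M)$ is $\bar{\mathcal{G}}_\varrho(\dot\varrho,\dot\varrho)=\int_M(|\nabla\theta|^2+\xi^2)\varrho$, where $\theta\in C^\infty(M)$, $\xi\in\mathbb{R}$ are determined by $\dot\rho=-\operatorname{div}(\rho\nabla\theta)+\xi\rho$, $\int_M\dot\varrho=m\xi$ and $\xi m=\int_M\theta\varrho$;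 its Hamiltonian is $H$, and its geodesic equations in Hamiltonian form (Hamilton's equations for $H$ with respect to the pairing $\langle\dot\varrho,\theta\rangle=\int_M\theta\dot\varrho$) are the equations displayed in the claim.
   Formalization: For noncompact M, where boundary flux makes the claim false, it is assumed that the volume, momentum and kinetic-energy densities are integrable, have locally uniformly dominated time derivatives, and have no flux through infinity; for compact M nothing is added. *)

(* Defs.v *)
From HB Require Import structures.
From mathcomp Require Import all_boot all_order all_algebra.
From mathcomp Require Import all_classical all_reals all_analysis.
From mathcomp Require Import measurable_realfun.

Set Implicit Arguments.
Unset Strict Implicit.
Unset Printing Implicit Defensive.
Import Order.TTheory GRing.Theory Num.Theory.
Import numFieldNormedType.Exports.

Local Open Scope classical_set_scope.
Local Open Scope ring_scope.

(* [D] is meant to be open and [V], [W] finite-dimensional, in which case this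
   is the usual C^k on [D]; the values of [f] off [D] are irrelevant. *)
Fixpoint Ck_on (R : realType) (V W : normedModType R) (k : nat) (D : set V)
    (f : V -> W) : Prop :=
  match k with
  | 0 => forall x, D x -> {for x, continuous f}
  | k'.+1 => (forall x, D x -> differentiable f x) /\
             (forall v, Ck_on k' D ('D_v f))
  end.

Definition smooth_on (R : realType) (V W : normedModType R) (D : set V)
    (f : V -> W) : Prop := forall k, Ck_on k D f.

(* Lebesgue integral over R^n of a nonnegative Borel function, as an iterated
   integral (Tonelli). *)
Fixpoint integral_rV (R : realType) (n : nat) :
    ('rV[R]_n -> \bar R) -> \bar R :=
  match n with
  | 0 => fun f => f 0
  | m.+1 => fun f =>
      (\int[lebesgue_measure]_(s in [set: R])
         integral_rV (fun v : 'rV[R]_m =>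
           f (row_mx (const_mx s : 'rV[R]_1) v)))%E
  end.

Notation borel M := (g_sigma_algebraType (@open M)).

(* Smooth structure without boundary. [chart_inv i] is only meaningful on the
   image of [chart_map i]. [chart_at x] is a preferred chart around [x]; it is
   used only to give values at [x] to chart-independent expressions. *)
Record smooth_atlas (R : realType) (n : nat) (M : ptopologicalType) := SmoothAtlas {
  chart_index : Type;
  chart_dom : chart_index -> set M;
  chart_map : chart_index -> M -> 'rV[R]_n;
  chart_inv : chart_index -> 'rV[R]_n -> M;
  chart_at : M -> chart_index;
  chart_atP : forall x, chart_dom (chart_at x) x;
  chart_dom_open : forall i, open (chart_dom i);
  chart_im_open : forall i, open (chart_map i @` chart_dom i);
  chart_mapK : forall i x, chart_dom i x -> chart_inv i (chart_map i x) = x;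
  chart_map_continuous : forall i x, chart_dom i x ->
    {for x, continuous (chart_map i)};
  chart_inv_continuous : forall i y, (chart_map i @` chart_dom i) y ->
    {for y, continuous (chart_inv i)};
  chart_transition_smooth : forall i j,
    smooth_on (chart_map i @` (chart_dom i `&` chart_dom j))
              (chart_map j \o chart_inv i);
  atlas_hausdorff : hausdorff_space M;
  atlas_second_countable : @second_countable M
}.

Section Manifold.
Context (R : realType) (n : nat) (M : ptopologicalType) (A : smooth_atlas R n M).

Definition chart_im (i : chart_index A) : set 'rV[R]_n :=
  chart_map i @` chart_dom i.

Definition smooth (f : M -> R) : Prop :=
  forall i : chart_index A, smooth_on (chart_im i) (f \o chart_inv i : _ -> R^o).

(* Joint smoothness on [J] x M of a time-dependent function. *)
Definition smooth_curve (J : set R) (u : R -> M -> R) : Prop :=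
  forall i : chart_index A,
    smooth_on (J `*` chart_im i : set (R^o * 'rV[R]_n)%type)
      (fun z : (R^o * 'rV[R]_n)%type => u z.1 (chart_inv i z.2) : R^o).

Record riemannian_metric := RiemannianMetric {
  gmx :> chart_index A -> 'rV[R]_n -> 'M[R]_n;
  gmx_smooth : forall i, smooth_on (chart_im i) (gmx i);
  gmx_sym : forall i y, chart_im i y -> (gmx i y)^T = gmx i y;
  gmx_pos : forall i y, chart_im i y -> forall v : 'rV[R]_n, v != 0 ->
    0 < (v *m gmx i y *m v^T) 0 0;
  gmx_compat : forall i j y,
    (chart_map i @` (chart_dom i `&` chart_dom j)) y -> forall v w : 'rV[R]_n,
    let tau : 'rV[R]_n -> 'rV[R]_n := chart_map j \o chart_inv i in
    v *m gmx i y *m w^T = 'd tau y v *m gmx j (tau y) *m ('d tau y w)^T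
}.

(* A volume form, regarded as a positive density: it is [vf_dens i] times
   Lebesgue measure in the chart [i]. It need not be the Riemannian volume
   (e.g. a Gaussian density on R^n). *)
Record volume_form := VolumeForm {
  vf_measure :> {measure set (borel M) -> \bar R};
  vf_dens : chart_index A -> 'rV[R]_n -> R;
  vf_dens_smooth : forall i, smooth_on (chart_im i) (vf_dens i : _ -> R^o);
  vf_dens_gt0 : forall i y, chart_im i y -> 0 < vf_dens i y;
  vf_densE : forall (i : chart_index A) (h : borel M -> \bar R),
    measurable_fun [set: borel M] h -> (forall x, 0 <= h x)%E ->
    (\int[vf_measure]_(x in (chart_dom i : set (borel M))) h x =
     integral_rV ((fun y => h (chart_inv i y) * (vf_dens i y)%:E) \_ (chart_im i)))%E
}.

(* A vector field is given by its components in every chart. *)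
Definition vector_field := chart_index A -> 'rV[R]_n -> 'rV[R]_n.

Definition scale_field (f : M -> R) (X : vector_field) : vector_field :=
  fun i y => f (chart_inv i y) *: X i y.

Definition partial (k : 'I_n) (f : 'rV[R]_n -> R) (y : 'rV[R]_n) : R :=
  'D_(delta_mx 0 k : 'rV[R]_n) (f : _ -> R^o) y.

Variables (g : riemannian_metric) (mu : volume_form).

Definition grad (f : M -> R) : vector_field := fun i y =>
  (\row_k partial k (f \o chart_inv i) y) *m invmx (g i y).

Definition inner (X Y : vector_field) (x : M) : R :=
  let i := chart_at A x in let y := chart_map i x in
  (X i y *m g i y *m (Y i y)^T) 0 0.

Definition grad_sq (f : M -> R) : M -> R := inner (grad f) (grad f).

(* div X is defined by L_X mu = (div X) mu, with mu = (vf_dens i) dy. *)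
Definition divergence (X : vector_field) (x : M) : R :=
  let i := chart_at A x in let y := chart_map i x in
  (\sum_(k < n) partial k (fun z => vf_dens mu i z * X i z 0 k) y) / vf_dens mu i y.

(* rho such that rho mu is in Vol(M) *)
Definition in_Vol (rho : M -> R) : Prop :=
  [/\ smooth rho, (forall x, 0 < rho x) &
      mu.-integrable [set: borel M] (EFin \o rho)].

Definition total_volume (rho : M -> R) : R := \int[mu]_(x in [set: borel M]) rho x.

Definition xi (rho theta : M -> R) : R :=
  (total_volume rho)^-1 * \int[mu]_(x in [set: borel M]) (theta x * rho x).

Definition hamiltonian (rho theta : M -> R) : R :=
  2^-1 * \int[mu]_(x in [set: borel M]) (grad_sq theta x * rho x) +
  (2 * total_volume rho)^-1 *
    (\int[mu]_(x in [set: borel M]) (theta x * rho x)) ^+ 2.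

Definition geodesic (J : set R) (rho theta : R -> M -> R) : Prop :=
  [/\ smooth_curve J rho, smooth_curve J theta,
      (forall t, J t -> in_Vol (rho t)),
      (forall t x, J t ->
         derive1 (rho^~ x) t =
         - divergence (scale_field (rho t) (grad (theta t))) x
         + xi (rho t) (theta t) * rho t x) &
      (forall t x, J t ->
         derive1 (theta^~ x) t =
         - 2^-1 * grad_sq (theta t) x - xi (rho t) (theta t) * theta t x
         + xi (rho t) (theta t) ^+ 2 / 2)].

Definition cutoff (chi : M -> R) : Prop :=
  [/\ smooth chi, (forall x, 0 <= chi x <= 1) &
      exists2 K : set M, compact K & (forall x, ~ K x -> chi x = 0)].

(* The integral of [u t] with respect to mu exists and may be differentiated in
   time under the integral sign, and the flux of (u t) grad(theta t) through
   infinity vanishes. *)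
Definition tame_density (J : set R) (theta u : R -> M -> R) : Prop :=
  forall t, J t ->
  [/\ mu.-integrable [set: borel M] (EFin \o u t),
      (exists2 G : borel M -> R, mu.-integrable [set: borel M] (EFin \o G) &
        \forall s \near t, forall x, `|derive1 (u^~ x) s| <= G x) &
      (exists chi : nat -> M -> R,
        [/\ (forall k, cutoff (chi k)),
            (forall x, chi k x @[k --> \oo] --> (1 : R)) &
            \int[mu]_(x in [set: borel M])
               inner (grad (chi k)) (scale_field (u t) (grad (theta t))) x
               @[k --> \oo] --> (0 : R)])].

(* Decay of a solution at infinity for a noncompact M: the volume, momentum
   and kinetic energy densities are tame. On a compact M this is automatic
   (with chi = 1). *)
Definition decays_at_infinity (J : set R) (rho theta : R -> M -> R) : Prop :=
  [/\ tame_density J theta rho,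
      tame_density J theta (fun t x => theta t x * rho t x) &
      tame_density J theta (fun t x => grad_sq (theta t) x * rho t x)].

End Manifold.

(* Main.v *)
Require Import Defs.
From HB Require Import structures.
From mathcomp Require Import all_boot all_order all_algebra.
From mathcomp Require Import all_classical all_reals all_analysis.
From mathcomp Require Import measurable_realfun.
From mathcomp Require Import ring lra.
Import Order.TTheory GRing.Theory Num.Theory.
Import numFieldNormedType.Exports.
Local Open Scope classical_set_scope.
Local Open Scope ring_scope.
Set Implicit Arguments.
Unset Strict Implicit.
Unset Printing Implicit Defensive.

(* Along the flow, each of the densities u = rho, theta rho, |grad theta|^2 rho
   satisfies u_t = - div(u grad theta) + w with w = xi rho,
   |grad theta|^2 rho / 2 + xi^2 rho / 2 and - xi |grad theta|^2 rho
   respectively. Integrating over M, where the divergence terms drop out, gives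
   m' = P, P' = H and H' = 0 for the momentum P, the integral of theta rho,
   because P = xi m. Hence m'' = H, so the acceleration is the energy itself.
   The divergence theorem for compactly supported fields is proved in charts,
   where it follows from the translation invariance of the iterated Lebesgue
   integral, and is globalized by C^1 bump functions. *)

(** * Iterated integrals of compactly supported functions *)

(** The definitions evaluate [divergence] and [inner] at [x] in the chart [chart_at x], which may
    jump from point to point, and the volume form is known through one integral formula per chart.
    So before anything is integrated over [M], these expressions must be shown not to depend on the
    chart; even their continuity rests on this. For the divergence the usual route is the change of
    variables formula; here the fact that all charts compute the same measure [mu] takes its place.
    Integration by parts asks one derivative of the test functions, hence piecewise quadratic bumps
    and the class [C1_at]. Second derivatives of [theta] make the gradient a C^1 field and allow
    time and space derivatives to be exchanged. On a noncompact [M] the divergence terms drop out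
    through cutoffs tending to 1, whose flux tends to 0 by the decay hypothesis; a compact [M] is
    reduced to this case with all cutoffs equal to 1. *)

Lemma mx_norm_leP (R : realType) m n (A : 'M[R]_(m, n)) (r : R) :
  0 <= r -> (`|A| <= r <-> forall i j, `|A i j| <= r).
Proof.
move=> r0; rewrite {1}/Num.norm /= mx_normrE; split.
  by move=> /bigmax_leP[_ h] i j; exact: (h (i, j) isT).
by move=> h; apply/bigmax_leP; split => // -[i j] _; exact: h.
Qed.

Definition cons_rV (R : realType) n (s : R) (v : 'rV[R]_n) : 'rV[R]_n.+1 :=
  row_mx (const_mx s : 'rV_1) v.

Lemma cons_rVD (R : realType) n (s t : R) (v w : 'rV[R]_n) :
  cons_rV (s + t) (v + w) = cons_rV s v + cons_rV t w.
Proof.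
apply/rowP => i; rewrite !mxE; case: (fintype.split _) => j; by rewrite !mxE.
Qed.

Lemma cons_rV_surj (R : realType) n (y : 'rV[R]_n.+1) :
  exists s v, y = cons_rV s v.
Proof.
exists (y ord0 ord0), (rsubmx (y : 'rV_(1 + n))).
apply/rowP => i; rewrite /cons_rV mxE.
by case: splitP => j ij; rewrite mxE; congr (y _ _); apply/val_inj;
  rewrite //= ij ?(ord1 j).
Qed.

(** The matrix norm is the maximum norm, so a closed ball in dimension [n.+1] is the product of an
    interval and a ball in dimension [n]. This lets a support radius pass unchanged to slices. *)
Lemma cons_rV_norm_le (R : realType) n (s : R) (v : 'rV[R]_n) (r : R) :
  `|cons_rV s v| <= r <-> `|s| <= r /\ `|v| <= r.
Proof.
split=> [h|[hs hv]].
  have r0 : 0 <= r := le_trans (normr_ge0 _) h.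
  have {}h i := iffLR (mx_norm_leP _ r0) h ord0 i.
  split; first by have := h (lshift n (ord0 : 'I_1)); rewrite (row_mxEl (const_mx s : 'rV_1)) mxE.
  apply/mx_norm_leP => // i j; rewrite (ord1 i).
  by have := h (rshift 1 j); rewrite (row_mxEr (const_mx s : 'rV_1)).
have r0 : 0 <= r := le_trans (normr_ge0 _) hv.
apply/mx_norm_leP => // i j; rewrite (ord1 i) mxE.
case: (fintype.split _) => k; rewrite ?mxE //; exact: (iffLR (mx_norm_leP _ r0)).
Qed.

Lemma cons_rV_continuous_l (R : realType) n (v : 'rV[R]_n) :
  continuous (fun s : R => cons_rV s v).
Proof.
move=> s; apply/cvgrPdist_le => e e0.
have /cvgrPdist_le/(_ e e0) : id x @[x --> s] --> s by exact: cvg_id.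
apply: filterS => t te.
have -> : cons_rV s v - cons_rV t v = cons_rV (s - t) 0.
  by apply/(canLR (addrK _)); rewrite -cons_rVD subrK add0r.
by apply/cons_rV_norm_le; rewrite normr0 (ltW e0).
Qed.

Lemma cons_rV_continuous_r (R : realType) n (s : R) :
  continuous (fun v : 'rV[R]_n => cons_rV s v).
Proof.
move=> v; apply/(@cvgrPdist_le _ _ _ (nbhs v)) => e e0.
have /(@cvgrPdist_le _ _ _ (nbhs v))/(_ e e0) : id x @[x --> v] --> v by exact: cvg_id.
apply: filterS => t te.
have -> : cons_rV s v - cons_rV s t = cons_rV 0 (v - t).
  by apply/(canLR (addrK _)); rewrite -cons_rVD subrK add0r.
by apply/cons_rV_norm_le; rewrite normr0 (ltW e0).
Qed.

(** Dominated convergence speaks of sequences, so continuity of slice integrals is reached through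
    sequential continuity. *)
Lemma R_continuous_seq (R : realType) (f : R -> R) :
  (forall (u : R^nat) p, u k @[k --> \oo] --> p -> f (u k) @[k --> \oo] --> f p) ->
  continuous f.
Proof. by move=> h p; apply/(@cvg_nbhsP _ R^o) => u; exact: h. Qed.

(** The support radius [B] and the bound [S] are explicit because the induction on the dimension
    needs them uniform over slices and over sequences of functions; together they furnish the
    dominating function. *)
Definition test_fun (R : realType) n (B S : R) (F : 'rV[R]_n -> R) :=
  [/\ continuous F, (forall y, B < `|y| -> F y = 0) & forall y, `|F y| <= S].

Lemma test_funW (R : realType) n B B' S S' (F : 'rV[R]_n -> R) : B <= B' -> S <= S' ->
  test_fun B S F -> test_fun B' S' F.
Proof.
move=> BB' SS' [cF F0 FS]; split=> // y; last exact: le_trans (FS y) SS'.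
by move=> By; apply: F0; exact: le_lt_trans By.
Qed.

(** Real-valued twin of [integral_rV], in which linearity and limits are handled without infinities.
    It is used on test functions, where all slice integrals are finite. *)
Fixpoint iint (R : realType) n : ('rV[R]_n -> R) -> R :=
  match n with
  | 0 => fun F => F 0
  | m.+1 => fun F =>
      \int[lebesgue_measure]_(s in [set: R]) iint (fun v : 'rV[R]_m => F (cons_rV s v))
  end.

Lemma iint0 (R : realType) n : @iint R n (cst 0) = 0.
Proof.
elim: n => //= n IHn; rewrite (_ : (fun s => _) = cst 0).
  by rewrite Rintegral_cst // mul0r.
by apply/funext => s; exact: IHn.
Qed.

Section iterated_integral.
Context (R : realType).
Implicit Types (B S : R).

Lemma test_fun_slice n B S (F : 'rV[R]_n.+1 -> R) s :
  test_fun B S F -> test_fun B S (fun v => F (cons_rV s v)).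
Proof.
move=> [cF F0 FS]; split => // [v|v Bv].
  by apply: (@continuous_comp _ _ _ (cons_rV s) F); [exact: cons_rV_continuous_r|exact: cF].
apply: F0; rewrite ltNge; apply/negP => /cons_rV_norm_le[_].
by rewrite leNgt Bv.
Qed.

Let dom B S (s : R) : R := S * \1_(`[- B, B]%classic) s.

Let dom_int B S : lebesgue_measure.-integrable [set: R] (EFin \o dom B S).
Proof.
rewrite (_ : EFin \o _ = (fun s => S%:E * (\1_(`[- B, B]%classic) s)%:E)%E)//.
apply: integrableZl => //.
apply/integrableP; split; first exact/measurable_EFinP.
under eq_integral do rewrite gee0_abs ?lee_fin//.
rewrite integral_indic//= setIT lebesgue_measure_itv /=.
by case: ifP => // _; rewrite -EFinD ltry.
Qed.

Let int_dom B S : 0 <= B -> \int[lebesgue_measure]_(s in [set: R]) dom B S s = S * (B + B).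
Proof.
move=> B0; rewrite RintegralZl//; last first.
  have := dom_int B 1; rewrite /dom.
  by under eq_fun do rewrite /= mul1r.
rewrite /Rintegral integral_indic//= setIT lebesgue_measure_itv /= lte_fin.
case: ifPn; first by rewrite opprK.
rewrite -leNgt => BB; rewrite (_ : B = 0) ?addr0 //; lra.
Qed.

Lemma test_fun_integrable B S (h : R -> R) : continuous h ->
  (forall s, B < `|s| -> h s = 0) -> (forall s, `|h s| <= S) ->
  lebesgue_measure.-integrable [set: R] (EFin \o h).
Proof.
move=> ch h0 hS; apply: (@le_integrable _ _ _ _ _ _ _ _ _ _ (dom_int B S)) => //.
  by apply/measurable_EFinP; exact: continuous_measurable_fun.
move=> s _; rewrite lee_fin /dom indicE.
have [Bs|sB] := ltP B `|s|; first by rewrite h0// normr0.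
rewrite mem_set ?mulr1 ?(le_trans (hS s)) ?ler_norm//=.
by rewrite in_itv /= -ler_norml.
Qed.

(* Boundedness and sequential continuity are proved together by induction on
   [n]: the latter makes the slices integrable. *)
Lemma iint_bound_cvg n B S : 0 <= B ->
  (forall F : 'rV[R]_n -> R, test_fun B S F -> `|iint F| <= S * (B + B) ^+ n) /\
  (forall (F_ : nat -> 'rV[R]_n -> R) F, (forall k, test_fun B S (F_ k)) ->
     test_fun B S F -> (forall y, F_ k y @[k --> \oo] --> F y) ->
     iint (F_ k) @[k --> \oo] --> iint F).
Proof.
move=> B0; elim: n => [|n [bnd cvg_]]; first split.
- by move=> F [_ _ h] /=; rewrite expr0 mulr1.
- by move=> F_ F _ _ h /=; exact: h.
have slice0 (F : 'rV[R]_n.+1 -> R) s : test_fun B S F ->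
    B < `|s| -> iint (fun v => F (cons_rV s v)) = 0.
  move=> [_ F0 _] Bs.
  have -> : (fun v => F (cons_rV s v)) = cst 0.
    apply/funext => v; apply: F0; rewrite ltNge; apply/negP => /cons_rV_norm_le[].
    by rewrite leNgt Bs.
  exact: iint0.
(* Slices at converging parameters converge pointwise with common [B] and [S], so the convergence
   half of the induction hypothesis gives continuity in [s]. *)
have slice_cont (F : 'rV[R]_n.+1 -> R) : test_fun B S F ->
    continuous (fun s => iint (fun v => F (cons_rV s v))).
  move=> tF; apply: R_continuous_seq => u p up; apply: cvg_.
  - by move=> k; exact: test_fun_slice.
  - exact: test_fun_slice.
  move=> v; apply: (@cvg_comp _ _ _ u (fun s => F (cons_rV s v)) _ (nbhs p)) => //.
  have [cF _ _] := tF.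
  by apply: (@continuous_comp _ _ _ (fun s => cons_rV s v) F); [exact: cons_rV_continuous_l|exact: cF].
have slice_le (F : 'rV[R]_n.+1 -> R) s : test_fun B S F ->
    `|iint (fun v => F (cons_rV s v))| <= dom B (S * (B + B) ^+ n) s.
  move=> tF; rewrite /dom indicE.
  have [Bs|sB] := ltP B `|s|.
    (* Any slice, here the one at 0, shows that [S * (B + B) ^+ n] is nonnegative: it dominates a
       norm. *)
    rewrite slice0// normr0 mulr_ge0 // (le_trans _ (bnd _ (test_fun_slice 0 tF)))//.
  rewrite mem_set ?mulr1; first exact/bnd/test_fun_slice.
  by rewrite /= in_itv /= -ler_norml.
have slice_int (F : 'rV[R]_n.+1 -> R) : test_fun B S F ->
    lebesgue_measure.-integrable [set: R] (EFin \o (fun s => iint (fun v => F (cons_rV s v)))).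
  move=> tF; apply: (@test_fun_integrable B (S * (B + B) ^+ n)).
  - exact: slice_cont.
  - by move=> s; exact: slice0.
  - by move=> s; exact/bnd/test_fun_slice.
split.
  move=> F tF /=; apply: le_trans (le_normr_Rintegral _ (slice_int _ tF)) _ => //.
  rewrite exprSr mulrA -int_dom //; apply: le_Rintegral => //; last by move=> s _; exact: slice_le.
  apply: (@test_fun_integrable B (S * (B + B) ^+ n)).
  - by move=> s; apply: continuous_comp; [exact: slice_cont|exact: norm_continuous].
  - by move=> s Bs; rewrite slice0// normr0.
  - by move=> s; rewrite normr_id; exact/bnd/test_fun_slice.
move=> F_ F tF_ tF cF /=.
apply: fine_cvg; rewrite fineK; last first.
  by apply: integrable_fin_num => //; exact: slice_int.
have [|||||_ _ h] := @dominated_convergence _ _ R lebesgue_measure setT measurableT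
  (fun k s => (iint (fun v => F_ k (cons_rV s v)))%:E)
  (fun s => (iint (fun v => F (cons_rV s v)))%:E) (EFin \o dom B (S * (B + B) ^+ n)).
- by move=> k; apply/measurable_EFinP; apply: continuous_measurable_fun; exact: slice_cont.
- apply/measurable_EFinP; apply: continuous_measurable_fun; exact: slice_cont.
- apply/aeW => s _; apply: cvg_EFin; first exact: nearW.
  apply: cvg_; [by move=> k; exact: test_fun_slice|exact: test_fun_slice|].
  by move=> v; exact: cF.
- exact: dom_int.
- by apply/aeW => s k _; rewrite lee_fin; exact: slice_le.
- exact: h.
Qed.

End iterated_integral.

Section iint_theory.
Context (R : realType) (n : nat).
Implicit Types (F G : 'rV[R]_n -> R) (B S : R).

Lemma test_fun_slice_continuous B S (F : 'rV[R]_n.+1 -> R) : 0 <= B ->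
  test_fun B S F -> continuous (fun s => iint (fun v => F (cons_rV s v))).
Proof.
move=> B0 tF; apply: R_continuous_seq => u p up.
apply: (iint_bound_cvg n S B0).2.
- by move=> k; exact: test_fun_slice.
- exact: test_fun_slice.
move=> v; apply: (@cvg_comp _ _ _ u (fun s => F (cons_rV s v)) _ (nbhs p)) => //.
have [cF _ _] := tF.
by apply: (@continuous_comp _ _ _ (fun s => cons_rV s v) F); [exact: cons_rV_continuous_l|exact: cF].
Qed.

Lemma test_fun_slice_integrable B S (F : 'rV[R]_n.+1 -> R) : 0 <= B ->
  test_fun B S F -> lebesgue_measure.-integrable [set: R]
    (EFin \o (fun s => iint (fun v => F (cons_rV s v)))).
Proof.
move=> B0 tF; apply: (@test_fun_integrable _ B (S * (B + B) ^+ n)).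
- exact: test_fun_slice_continuous tF.
- move=> s Bs; have [_ F0 _] := tF.
  rewrite (_ : (fun v => _) = cst 0) ?iint0//; apply/funext => v.
  apply: F0; rewrite ltNge; apply/negP => /cons_rV_norm_le[].
  by rewrite leNgt Bs.
- by move=> s; apply: (iint_bound_cvg n S B0).1; exact: test_fun_slice.
Qed.
End iint_theory.

Lemma test_funD (R : realType) n B S S' (F G : 'rV[R]_n -> R) :
  test_fun B S F -> test_fun B S' G -> test_fun B (S + S') (F \+ G).
Proof.
move=> [cF F0 FS] [cG G0 GS]; split.
- by move=> x; exact: (@continuousD _ _ _ F G x (cF x) (cG x)).
- by move=> y By /=; rewrite F0 ?G0 ?addr0.
- by move=> y /=; rewrite (le_trans (ler_normD _ _)) ?lerD.
Qed.

Lemma test_funZ (R : realType) n B S c (F : 'rV[R]_n -> R) :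
  test_fun B S F -> test_fun B (`|c| * S) (fun y => c * F y).
Proof.
move=> [cF F0 FS]; split.
- by move=> x; apply: (@continuousM _ _ (cst c) F); [exact: cst_continuous|exact: cF].
- by move=> y By /=; rewrite F0 ?mulr0.
- by move=> y /=; rewrite normrM ler_wpM2l.
Qed.

Lemma iintD (R : realType) n B S S' (F G : 'rV[R]_n -> R) : 0 <= B ->
  test_fun B S F -> test_fun B S' G -> iint (F \+ G) = iint F + iint G.
Proof.
move=> B0; elim: n F G => //= n IHn F G tF tG.
rewrite -RintegralD//; [|exact: test_fun_slice_integrable tF|exact: test_fun_slice_integrable tG].
by apply: eq_Rintegral => s _; rewrite -IHn//; exact: test_fun_slice.
Qed.

Lemma iintZ (R : realType) n B S c (F : 'rV[R]_n -> R) : 0 <= B ->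
  test_fun B S F -> iint (fun y => c * F y) = c * iint F.
Proof.
move=> B0; elim: n F => //= n IHn F tF.
rewrite -RintegralZl//; last exact: test_fun_slice_integrable tF.
by apply: eq_Rintegral => s _; rewrite -IHn//; exact: test_fun_slice.
Qed.

Lemma iint_sum (R : realType) n (I : Type) (r : seq I) B
    (F : I -> 'rV[R]_n -> R) : 0 <= B ->
  (forall i, exists S, test_fun B S (F i)) ->
  iint (fun y => \sum_(i <- r) F i y) = \sum_(i <- r) iint (F i).
Proof.
move=> B0 tF.
(* [iintD] asks for test functions on both sides, so the induction also carries a bound for the
   partial sum. *)
suff [] : (exists S, test_fun B S (fun y => \sum_(i <- r) F i y)) /\
  iint (fun y => \sum_(i <- r) F i y) = \sum_(i <- r) iint (F i) by [].
elim: r => [|i r [[S' IH1] IH2]].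
  rewrite big_nil (_ : (fun y => _) = cst 0); last by apply/funext => y; rewrite big_nil.
  split; last exact: iint0.
  by exists 0; split => // y; [exact: cst_continuous|rewrite normr0].
have [S tS] := tF i.
rewrite big_cons -IH2 (_ : (fun y => _) = F i \+ (fun y => \sum_(j <- r) F j y)); last first.
  by apply/funext => y; rewrite big_cons.
split.
  by exists (S + S'); exact: test_funD.
exact: (iintD B0 tS IH1).
Qed.

Lemma iint_ge0 (R : realType) n (F : 'rV[R]_n -> R) :
  (forall y, 0 <= F y) -> 0 <= iint F.
Proof.
elim: n F => //= n IHn F F0; apply: Rintegral_ge0 => s _; exact: IHn.
Qed.

(** Slice integrals of a test function are integrable, hence finite at each layer, and [fine] loses
    nothing. This carries the formula [vf_densE] over to [iint]. *)
Lemma integral_rV_iint (R : realType) n B S (F : 'rV[R]_n -> R) : 0 <= B ->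
  test_fun B S F -> integral_rV (fun y => (F y)%:E) = (iint F)%:E.
Proof.
move=> B0; elim: n F => //= n IHn F tF.
under eq_integral do rewrite (IHn _ (test_fun_slice _ tF)).
rewrite fineK//; apply: integrable_fin_num => //.
exact: test_fun_slice_integrable tF.
Qed.

(** Uniqueness of Lebesgue measure: the pushforward under a translation gives every interval []a,
    b]] its length. *)
Lemma lebesgue_measure_shift (R : realType) (c : R) (A : set R) : measurable A ->
  pushforward lebesgue_measure ((fun s => s + c) : R -> measurableTypeR R) A =
  lebesgue_measure A.
Proof.
have mshift : measurable_fun [set: measurableTypeR R]
    ((fun s => s + c) : measurableTypeR R -> measurableTypeR R).
  exact: measurable_funD.
move=> mA; apply/esym.
apply: (@lebesgue_measure_unique _ (pushforward lebesgue_measure _)) => //=.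
move=> _ [[a b]] _ <-.
rewrite /pushforward.
rewrite (_ : _ @^-1` _ = `](a - c), (b - c)]%classic); last first.
  by apply/seteqP; split => s /=; rewrite !in_itv /= ltrBlDr lerBrDr.
rewrite !lebesgue_measure_itv /= !lte_fin ltrD2r; case: ifP => // _.
by rewrite -!EFinD; congr EFin; ring.
Qed.

Lemma Rintegral_shift (R : realType) (h : R -> R) (c : R) :
  continuous h -> lebesgue_measure.-integrable [set: R] (EFin \o (fun s => h (s + c))) ->
  \int[lebesgue_measure]_(s in [set: R]) h (s + c) =
  \int[lebesgue_measure]_(s in [set: R]) h s.
Proof.
move=> ch ih; rewrite /Rintegral; congr fine.
have mshift : measurable_fun [set: measurableTypeR R]
    ((fun s => s + c) : measurableTypeR R -> measurableTypeR R).
  exact: measurable_funD.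
have mh : measurable_fun [set: measurableTypeR R] (EFin \o h).
  by apply/measurable_EFinP; exact: continuous_measurable_fun.
rewrite [RHS](eq_measure_integral (pushforward lebesgue_measure
    ((fun s => s + c) : R -> measurableTypeR R))) => [|A mA _]; last first.
  by rewrite /= lebesgue_measure_shift.
by rewrite [RHS](@integral_pushforward _ _ _ _ _ _ mshift lebesgue_measure setT (EFin \o h))// preimage_setT.
Qed.

Lemma test_fun_shift (R : realType) n B S (F : 'rV[R]_n -> R) (w : 'rV[R]_n) :
  test_fun B S F -> test_fun (B + `|w|) S (fun y => F (y + w)).
Proof.
move=> [cF F0 FS]; split => //.
  move=> x; apply: (@continuous_comp _ _ _ (fun y : 'rV[R]_n => y + w) F); last exact: cF.
  by apply: (@continuousD _ 'rV[R]_n _ id (cst w)); [exact: cvg_id|exact: cst_continuous].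
move=> y By; apply: F0; rewrite -ltrBrDr in By.
by apply: lt_le_trans By _; rewrite lerBlDr -{1}(addrK w y) ler_normB.
Qed.

Lemma iint_shift (R : realType) n B S (F : 'rV[R]_n -> R) (w : 'rV[R]_n) : 0 <= B ->
  test_fun B S F -> iint (fun y => F (y + w)) = iint F.
Proof.
move=> B0; elim: n F w => [|n IHn] F w tF /=.
  by congr F; apply/rowP => -[].
have [c [w' wE]] := cons_rV_surj w.
have sE s : iint (fun v => F (cons_rV s v + w)) = iint (fun v => F (cons_rV (s + c) v)).
  rewrite -(IHn (fun v => F (cons_rV (s + c) v)) w') ; last exact: test_fun_slice.
  by congr iint; apply/funext => v; rewrite wE cons_rVD.
under eq_Rintegral do rewrite sE.
apply: (Rintegral_shift (h := fun s => iint (fun v => F (cons_rV s v)))).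
  exact: test_fun_slice_continuous tF.
(* The shifted slice integrals are integrable because the shifted function is again a test function,
   with support radius enlarged by the norm of [w]. *)
have := test_fun_slice_integrable _ (test_fun_shift w tF).
by under eq_fun do rewrite /= sE; apply; rewrite addr_ge0.
Qed.

(** A derivative in direction [v] sees only the restriction to one line, so functions on different
    spaces that agree along corresponding lines share it. Translations, slices and the passage
    between manifold and chart all reduce to this. *)
Lemma derive_along (R : realType) (V W U : normedModType R) (F : V -> U) (G : W -> U)
    (a v : V) (b w : W) : (forall h : R, F (h *: v + a) = G (h *: w + b)) ->
  (derivable F a v <-> derivable G b w) /\ 'D_v F a = 'D_w G b.
Proof.
move=> FG.
have E : (fun h : R => h^-1 *: ((F \o shift a) (h *: v) - F a)) =
         (fun h : R => h^-1 *: ((G \o shift b) (h *: w) - G b)).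
  by apply/funext => h /=; rewrite FG; have := FG 0; rewrite !scale0r !add0r => ->.
by split; rewrite /derivable /derive E.
Qed.

Lemma mean_value_derive (R : realType) (V : normedModType R) (F : V -> R) (y v : V) (h : R) :
  0 < h -> (forall c, 0 <= c <= h -> derivable F (y + c *: v) v) ->
  exists2 c, 0 <= c <= h & F (y + h *: v) - F y = 'D_v F (y + c *: v) * h.
Proof.
move=> h0 dF.
have dline t : 0 <= t <= h ->
    is_derive t (1 : R) (fun t => F (y + t *: v)) ('D_v F (y + t *: v)).
  move=> th.
  have [d1 d2] : (derivable (fun t : R => F (y + t *: v)) t (1 : R) <->
      derivable F (y + t *: v) v) /\
      'D_(1 : R) (fun t : R => F (y + t *: v)) t = 'D_v F (y + t *: v).
    apply: derive_along => k.
    by rewrite scalerDl addrCA; congr (F (_ *: _ + _)); exact: mulr1.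
  by split => //; apply/d1; exact: dF.
have cline : {within `[0, h], continuous (fun t : R => F (y + t *: v))}.
  apply: derivable_within_continuous => t; rewrite in_itv /= => th.
  by have [] := dline t th.
have [|c cI E] := @MVT _ _ (fun t => 'D_v F (y + t *: v)) 0 h h0 _ cline.
  by move=> t; rewrite in_itv /= => /andP[/ltW ? /ltW ?]; apply: dline; apply/andP.
exists c; last by rewrite scale0r addr0 subr0 in E.
by move: cI; rewrite in_itv /= => /andP[/ltW -> /ltW ->].
Qed.

(* Translation invariance kills the integrals of the difference quotients. *)
Lemma iint_derive (R : realType) n B S (F : 'rV[R]_n -> R) (v : 'rV[R]_n) : 0 <= B ->
  test_fun B S F -> (forall y, derivable F y v) -> test_fun B S ('D_v F) ->
  iint ('D_v F) = 0.
Proof.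
move=> B0 tF dF tD.
(* Steps [1/(k+1)] are nonzero and at most 1, so all difference quotients vanish beyond one common
   radius, [B] plus the norm of [v]. *)
pose h k : R := k.+1%:R^-1.
have h0 k : h k != 0 by rewrite invr_eq0 pnatr_eq0.
pose q k y := (h k)^-1 * (F (y + h k *: v) - F y).
have h1 k : `|h k *: v| <= `|v|.
  rewrite normrZ ler_piMl// ger0_norm ?invr_ge0// invf_le1//.
  by rewrite ler1n.
have tq k : test_fun (B + `|v|) S (q k).
  have : test_fun (B + `|v|) (`|(h k)^-1| * (S + `|-1| * S)) (q k).
    apply: test_funZ; apply: test_funD.
      by apply: test_funW (lexx S) (test_fun_shift _ tF); rewrite lerD2l.
    rewrite (_ : (fun y => - F y) = (fun y => -1 * F y)); last by apply/funext => y; rewrite mulN1r.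
    by apply: test_funZ; apply: test_funW (lexx S) tF; rewrite lerDl.
  (* The bound just obtained grows with [k]. The mean value theorem replaces it by [S], which bounds
     the derivative; dominated convergence requires this uniformity. *)
  case=> cq q0 _; split=> // y; rewrite /q.
  have [||c _ ->] := @mean_value_derive _ _ F y v (h k) => //.
    by rewrite invr_gt0 ltr0n.
  by rewrite mulrC mulfK//; case: tD.
have B1 : 0 <= B + `|v| by rewrite addr_ge0.
have q_int k : iint (q k) = 0.
  have tS : test_fun (B + `|v|) S F by apply: test_funW (lexx S) tF; rewrite lerDl.
  have tS' : test_fun (B + `|v|) S (fun y => F (y + h k *: v)).
    by apply: test_funW (lexx S) (test_fun_shift _ tF); rewrite lerD2l.
  have tN : test_fun (B + `|v|) (`|-1| * S) (fun y => -1 * F y) by exact: test_funZ.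
  rewrite /q (iintZ _ B1 (S := S + `|-1| * S)).
    rewrite (_ : (fun y => F (y + h k *: v) - F y) = (fun y => F (y + h k *: v)) \+ (fun y => -1 * F y)).
      rewrite (iintD B1 tS' tN) (iintZ _ B1 tS) (iint_shift _ B0 tF).
      by rewrite mulN1r subrr mulr0.
    by apply/funext => y /=; rewrite mulN1r.
  rewrite (_ : (fun y => F (y + h k *: v) - F y) = (fun y => F (y + h k *: v)) \+ (fun y => -1 * F y)).
    exact: test_funD.
  by apply/funext => y /=; rewrite mulN1r.
have tD' : test_fun (B + `|v|) S ('D_v F) by apply: test_funW (lexx S) tD; rewrite lerDl.
have := (iint_bound_cvg n S B1).2 q ('D_v F) tq tD'.
under eq_fun do rewrite q_int.
have cq y : q k y @[k --> \oo] --> 'D_v F y.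
  have : k^-1 *: (F (k *: v + y) - F y) @[k --> (0:R)^'] --> 'D_v F y by exact: dF.
  move=> /cvgr_dnbhsP/(_ h (conj h0 (@cvg_harmonic R))).
  by under eq_fun do rewrite [_ + y]addrC.
by move=> /(_ cq) /cvg_lim <- //; rewrite lim_cst.
Qed.

(** If [h p > 0], continuity keeps [h] above [h p / 2] on an interval of length [d / 2], which
    already contributes a positive integral. *)
Lemma Rintegral_eq0 (R : realType) (h : R -> R) : continuous h -> (forall s, 0 <= h s) ->
  lebesgue_measure.-integrable [set: R] (EFin \o h) ->
  \int[lebesgue_measure]_(s in [set: R]) h s = 0 -> forall s, h s = 0.
Proof.
move=> ch h0 ih i0 p; apply/eqP; apply: contraT => hp.
have {}hp : 0 < h p by rewrite lt_neqAle eq_sym hp h0.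
have /cvgrPdist_lt/(_ (h p / 2)) := ch p.
rewrite divr_gt0// => /(_ isT) /nbhs_ballP[d /= d0 hd].
have hd2 s : s \in `[p, p + d / 2] -> h p / 2 <= h s.
  rewrite in_itv /= => /andP[ps sp].
  have /hd /= : ball p d s.
    rewrite /ball /= ltr_norml; apply/andP; split; lra.
  by rewrite ltr_norml => /andP[_]; lra.
suff : (0 < \int[lebesgue_measure]_(s in [set: R]) (h s)%:E)%E.
  rewrite -(fineK (integrable_fin_num measurableT ih)) lte_fin.
  by rewrite -/(Rintegral lebesgue_measure setT h) i0 ltxx.
have mh : measurable_fun [set: R] (EFin \o h) by case/integrableP: ih.
apply: (@lt_le_trans _ _ (\int[lebesgue_measure]_(s in `[p, (p + d / 2)%R]) (h p / 2)%:E)%E).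
  rewrite integral_cst//= lebesgue_measure_itv /= lte_fin ltrDl divr_gt0//.
  by rewrite -EFinD -EFinM lte_fin mulr_gt0 ?divr_gt0//; lra.
apply: (@le_trans _ _ (\int[lebesgue_measure]_(s in `[p, (p + d / 2)%R]) (h s)%:E)%E).
  apply: ge0_le_integral => //.
  - by move=> s _; rewrite lee_fin; lra.
  - exact: measurable_funS mh.
by apply: ge0_subset_integral => //= s _; rewrite lee_fin.
Qed.

Lemma iint_eq0 (R : realType) n B S (F : 'rV[R]_n -> R) : 0 <= B ->
  test_fun B S F -> (forall y, 0 <= F y) -> iint F = 0 -> forall y, F y = 0.
Proof.
move=> B0; elim: n F => [|n IHn] F tF F0 /= iF y.
  by rewrite -iF; congr F; apply/rowP => -[].
have [s [v ->]] := cons_rV_surj y.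
apply: (IHn (fun v => F (cons_rV s v))) => //; first exact: test_fun_slice.
apply: (Rintegral_eq0 (h := fun s => iint (fun v => F (cons_rV s v)))) => //.
- exact: test_fun_slice_continuous tF.
- by move=> t; exact: iint_ge0.
- exact: test_fun_slice_integrable tF.
Qed.

(** * C^1 functions *)

(** The difference [g - f] vanishes near [x], so its expansion holds with differential 0 and zero
    remainder; adding it to [f] gives [g]. *)
Lemma near_eq_differentiable (R : realType) (V W : normedModType R) (f g : V -> W) x :
  {near x, f =1 g} -> differentiable f x -> differentiable g x.
Proof.
move=> fg df.
have h0 : \forall y \near x, (g - f) y = 0.
  by apply: filterS fg => y; rewrite !fctE => ->; rewrite subrr.
have hx : (g - f) x = 0 := nbhs_singleton h0.
have hE : (g - f) \o shift x = cst ((g - f) x) + \0 +o_ 0 id.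
  apply/eqaddoP => e /= e0.
  have : \forall y \near (0 : V), (g - f) (y + x) = 0.
    by move: h0; rewrite (near_shift 0 x)/=; apply: filterS => y /=; rewrite subr0.
  apply: filterS => y E; rewrite [X in `|X|](_ : _ = 0) ?normr0 ?mulr_ge0// ?ltW//.
  by transitivity ((g - f) (y + x) - ((g - f) x + 0)) => //; rewrite E hx addr0 subrr.
have dh : 'd (g - f) x = \0 :> (V -> W).
  by apply: diff_unique hE; exact: cst_continuous.
rewrite (_ : g = f + (g - f)); last by apply/funext => y; rewrite !fctE subrKC.
apply: differentiableD => //; apply/diff_locallyP; rewrite dh; split => //.
exact: cst_continuous.
Qed.

Section C1_at.
Context (R : realType).

(** Differentiability is asked near [x], continuity of the derivatives at [x] alone: enough for
    Schwarz' theorem, and stable under algebra and under local changes of the function. *)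
Definition C1_at (V : normedModType R) (f : V -> R) (x : V) :=
  (\forall z \near x, differentiable f z) /\ forall v, {for x, continuous ('D_v f)}.

Lemma near_eq_continuous (T U : topologicalType) (f g : T -> U) x :
  {near x, f =1 g} -> {for x, continuous f} -> {for x, continuous g}.
Proof.
move=> fg cf; have fgx : f x = g x := nbhs_singleton fg; rewrite /prop_for /continuous_at -fgx.
exact: cvg_trans (near_eq_cvg fg) cf.
Qed.

Section C1_theory.
Context (V : normedModType R).
Implicit Types (f g : V -> R) (x : V).

Lemma near_eq_near f g x : {near x, f =1 g} -> \forall z \near x, {near z, f =1 g}.
Proof. by move/nbhs_interior. Qed.

Lemma C1_near_eq f g x : {near x, f =1 g} -> C1_at f x -> C1_at g x.
Proof.
move=> /near_eq_near fg [df cf]; split.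
  by apply: filterS2 fg df => z; exact: near_eq_differentiable.
move=> v; apply: near_eq_continuous (cf v).
by apply: filterS fg => z fg; exact: near_eq_derive.
Qed.

Lemma C1_near f x : C1_at f x -> (forall v, \forall z \near x, derivable f z v).
Proof. by case=> df _ v; apply: filterS df => z; exact: diff_derivable. Qed.

Lemma C1_differentiable f x : C1_at f x -> differentiable f x.
Proof. by case=> /nbhs_singleton. Qed.

Lemma C1_derivable f x v : C1_at f x -> derivable f x v.
Proof. by move=> /C1_differentiable; exact: diff_derivable. Qed.

Lemma C1_continuous f x : C1_at f x -> {for x, continuous f}.
Proof. by move=> /C1_differentiable; exact: differentiable_continuous. Qed.

Lemma C1_cst (c : R) x : C1_at (fun=> c) x.
Proof.
split; first by apply: nearW => z; exact: differentiable_cst.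
move=> v; rewrite (_ : 'D_v _ = cst 0); first exact: cst_continuous.
by apply/funext => z; exact: derive_cst.
Qed.

Lemma C1D f g x : C1_at f x -> C1_at g x -> C1_at (fun z => f z + g z) x.
Proof.
move=> Cf Cg; split.
  by have [df _] := Cf; have [dg _] := Cg; apply: filterS2 df dg => z; exact: differentiableD.
move=> v; apply: (@near_eq_continuous _ _ (fun z => 'D_v f z + 'D_v g z)).
  by apply: filterS2 (C1_near Cf v) (C1_near Cg v) => z df dg; rewrite -deriveD.
by apply: (@continuousD _ _ _ ('D_v f) ('D_v g)); [exact: Cf.2|exact: Cg.2].
Qed.

Lemma C1M f g x : C1_at f x -> C1_at g x -> C1_at (fun z => f z * g z) x.
Proof.
move=> Cf Cg; split.
  by have [df _] := Cf; have [dg _] := Cg; apply: filterS2 df dg => z; exact: differentiableM.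
move=> v; apply: (@near_eq_continuous _ _ (fun z => f z * 'D_v g z + g z * 'D_v f z)).
  by apply: filterS2 (C1_near Cf v) (C1_near Cg v) => z df dg; apply/esym; exact: deriveM.
apply: (@continuousD _ _ _ (fun z => f z * 'D_v g z) (fun z => g z * 'D_v f z)).
  by apply: (@continuousM _ _ f ('D_v g)); [exact: C1_continuous|exact: Cg.2].
by apply: (@continuousM _ _ g ('D_v f)); [exact: C1_continuous|exact: Cf.2].
Qed.

Lemma C1V f x : f x != 0 -> C1_at f x -> C1_at (fun z => (f z)^-1) x.
Proof.
move=> fx Cf; have [df cf] := Cf.
have f0 : \forall z \near x, f z != 0.
  by apply: (cvgr_neq0 (f x)) => //; exact: C1_continuous.
split; first by apply: filterS2 df f0 => z; exact: differentiableV.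
move=> v; apply: (@near_eq_continuous _ _ (fun z => - (f z)^-2 * 'D_v f z)).
  by apply: filterS2 f0 (C1_near Cf v) => z fz df'; apply/esym; exact: deriveV.
apply: (@continuousM _ _ (fun z => - (f z)^-2) ('D_v f)); last exact: cf.
apply: (@continuousN _ _ _ (fun z => (f z)^-2)).
apply: (@continuousV _ _ (fun z => f z ^+ 2)); first by rewrite expf_neq0.
by apply: (@continuousM _ _ f f); exact: C1_continuous.
Qed.

Lemma C1_sum (I : Type) (r : seq I) (P : pred I) (F : I -> V -> R) x :
  (forall i, P i -> C1_at (F i) x) -> C1_at (fun z => \sum_(i <- r | P i) F i z) x.
Proof.
move=> CF; elim: r => [|i r IH].
  by under eq_fun do rewrite big_nil; exact: C1_cst.
under eq_fun do rewrite big_cons; case Pi: (P i); last exact: IH.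
exact: (C1D (CF i Pi) IH).
Qed.

Lemma C1_prod (I : Type) (r : seq I) (P : pred I) (F : I -> V -> R) x :
  (forall i, P i -> C1_at (F i) x) -> C1_at (fun z => \prod_(i <- r | P i) F i z) x.
Proof.
move=> CF; elim: r => [|i r IH].
  by under eq_fun do rewrite big_nil; exact: C1_cst.
under eq_fun do rewrite big_cons; case Pi: (P i); last exact: IH.
exact: (C1M (CF i Pi) IH).
Qed.

Lemma C1N f x : C1_at f x -> C1_at (fun z => - f z) x.
Proof.
by move=> Cf; under eq_fun do rewrite -mulN1r; exact: (C1M (C1_cst (-1) x) Cf).
Qed.

Lemma C1B f g x : C1_at f x -> C1_at g x -> C1_at (fun z => f z - g z) x.
Proof. by move=> Cf Cg; exact: (C1D Cf (C1N Cg)). Qed.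

Lemma C1_det n (A : V -> 'M[R]_n) x :
  (forall i j, C1_at (fun z => A z i j) x) -> C1_at (fun z => \det (A z)) x.
Proof.
move=> CA; apply: C1_sum => s _; apply: C1M; first exact: C1_cst.
by apply: C1_prod => i _; exact: CA.
Qed.

(** Cramer's rule: the entries of the inverse are polynomials in the entries divided by the
    determinant. Invertibility near [x] matters because [invmx] returns its argument on singular
    matrices. *)
Lemma C1_invmx n (A : V -> 'M[R]_n) x :
  (forall i j, C1_at (fun z => A z i j) x) -> (\forall z \near x, A z \in unitmx) ->
  forall i j, C1_at (fun z => invmx (A z) i j) x.
Proof.
move=> CA uA i j.
apply: (@C1_near_eq (fun z => (\det (A z))^-1 * \adj (A z) i j)).
  by apply: filterS uA => z uz; rewrite /invmx uz [RHS]mxE.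
apply: C1M.
  apply: C1V; last exact: C1_det.
  by have := nbhs_singleton uA; rewrite unitmxE unitfE.
under eq_fun do rewrite mxE; apply: C1M; first exact: C1_cst.
by apply: C1_det => k l; under eq_fun do rewrite !mxE; exact: CA.
Qed.

End C1_theory.

Lemma C1_comp1 (V : normedModType R) (h : R -> R) (f : V -> R) x :
  (forall s, derivable h s 1) -> continuous (derive1 h) -> C1_at f x ->
  C1_at (fun z => h (f z)) x.
Proof.
move=> dh ch Cf; have [df cf] := Cf.
have dh' s : differentiable h s by apply/derivable1_diffP.
split; first by apply: filterS df => z df; exact: differentiable_comp.
move=> v; apply: (@near_eq_continuous _ _ (fun z => derive1 h (f z) * 'D_v f z)).
  apply: filterS df => z df.
  rewrite [RHS]deriveE; last exact: differentiable_comp.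
  rewrite diff_comp//= deriveE// (deriv1E (dh _))/=.
  by rewrite [RHS]mulrC.
apply: (@continuousM _ _ (fun z => derive1 h (f z)) ('D_v f)); last exact: cf.
by apply: continuous_comp; [exact: C1_continuous|exact: ch].
Qed.

Lemma C1_snd (V W : normedModType R) (f : W -> R) (z : V * W) :
  C1_at f z.2 -> C1_at (fun z : V * W => f z.2) z.
Proof.
move=> [df cf]; split.
  have : \forall w \near z, differentiable f w.2.
    exact: (cvg_snd (F := nbhs z.1) (G := nbhs z.2)) _ df.
  apply: filterS => w dw; apply: (@differentiable_comp _ _ _ _ snd f) => //.
  by apply: (@linear_differentiable _ _ _ (@snd V W)) => u; exact: cvg_snd.
move=> v.
apply: (@continuous_comp _ _ _ (@snd V W) ('D_(v.2) f)); last exact: cf.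
exact: cvg_snd.
Qed.

Lemma C1_slice (V W : normedModType R) (f : V * W -> R) (a : V) (b : W) :
  C1_at f (a, b) -> C1_at (fun w => f (a, w)) b.
Proof.
move=> [df cf].
have cpair : {for b, continuous (fun w => (a, w))}.
  by apply: cvg_pair => //; exact: cvg_cst.
split.
  have : \forall w \near b, differentiable f (a, w) by exact: (cpair _ df).
  apply: filterS => w dw; apply: (@differentiable_comp _ _ _ _ (fun w => (a, w)) f) => //.
move=> v.
rewrite (_ : 'D_v _ = (fun w => 'D_((0, v) : V * W) f (a, w))); last first.
  apply/funext => w; apply: (derive_along _).2 => h /=.
  have -> : h *: ((0, v) : V * W) + (a, w) = (h *: 0 + a, h *: v + w) by [].
  by rewrite scaler0 add0r.
exact: (@continuous_comp _ _ _ (fun w => (a, w)) ('D_((0, v) : V * W) f) b cpair (cf _)).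
Qed.

(** The second difference of [f] over a parallelogram with sides [h *: v] and [h *: w] can be
    evaluated in either order. This serves to commute the time derivative with the partial
    derivatives of [theta]. *)
Lemma schwarz (V : normedModType R) (f : V -> R) (x v w : V) :
  C1_at f x -> C1_at ('D_v f) x -> C1_at ('D_w f) x ->
  'D_w ('D_v f) x = 'D_v ('D_w f) x.
Proof.
move=> Cf Cv Cw.
have [d d0 hd] : exists2 d : R, 0 < d & forall z, `|z - x| < d ->
    [/\ differentiable f z, differentiable ('D_v f) z & differentiable ('D_w f) z].
  have : \forall z \near x, [/\ differentiable f z, differentiable ('D_v f) z &
      differentiable ('D_w f) z].
    by apply: filterS3 Cf.1 Cv.1 Cw.1.
  move=> /nbhs_ballP[d /= d0 hd]; exists d => // z zx; apply: hd.
  by rewrite -ball_normE /= distrC.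
(* A displacement [a *: v + b *: w] with [a] and [b] at most [h] has norm less than [h * s]; the
   summand 1 keeps [s] positive when both vectors vanish. *)
pose s := `|v| + `|w| + 1.
have s0 : 0 < s by rewrite ltr_wpDl// addr_ge0.
have near_lt e h a b : 0 < e -> 0 < h < e / s -> 0 <= a <= h -> 0 <= b <= h ->
    `|x + a *: v + b *: w - x| < e.
  move=> e0 /andP[h0 hs] /andP[a0 ah] /andP[b0 bh].
  rewrite -[x + _ + _]addrA [x + _]addrC addrK (le_lt_trans (ler_normD _ _))// !normrZ !ger0_norm//.
  rewrite ltr_pdivlMr// in hs; apply: le_lt_trans hs.
  by rewrite !mulrDr mulr1 ler_wpDr ?(ltW h0)// lerD// ler_wpM2r.
(* The second difference of f at scale h is h^2 times either mixed derivative
   at a nearby point. *)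
have diff2 (v' w' : V) h : 0 < h ->
    (forall a b, 0 <= a <= h -> 0 <= b <= h -> differentiable f (x + a *: v' + b *: w') /\
      differentiable ('D_v' f) (x + a *: v' + b *: w')) ->
    exists a b, [/\ 0 <= a <= h, 0 <= b <= h &
      f (x + h *: v' + h *: w') - f (x + h *: v') - f (x + h *: w') + f x =
      'D_w' ('D_v' f) (x + a *: v' + b *: w') * h * h].
  move=> h0 df.
  have hh : 0 <= h <= h by rewrite lexx ltW.
  have h00 : 0 <= (0 : R) <= h by rewrite lexx ltW.
  (* Mean value theorem twice: along [v'] for the increment [phi] of [f], then along [w'] for the
     derivative of [f] in direction [v']. *)
  pose phi z := f (z + h *: w') - f z.
  have dphi a : 0 <= a <= h -> is_derive (x + a *: v') v' phi
      ('D_v' f (x + a *: v' + h *: w') - 'D_v' f (x + a *: v')).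
    move=> ah.
    have d1 : derivable f (x + a *: v') v'.
      by apply: diff_derivable; have := (df a 0 ah h00).1; rewrite scale0r addr0.
    have d2 : is_derive (x + a *: v') v' (fun z => f (z + h *: w')) ('D_v' f (x + a *: v' + h *: w')).
      have [d2 d3] : (derivable (fun z => f (z + h *: w')) (x + a *: v') v' <->
          derivable f (x + a *: v' + h *: w') v') /\
          'D_v' (fun z => f (z + h *: w')) (x + a *: v') = 'D_v' f (x + a *: v' + h *: w').
        by apply: derive_along => k; rewrite -!addrA.
      split => //; apply/d2.
      exact: diff_derivable (df a h ah hh).1.
    split; first by apply: derivableB => //; exact: d2.
    have [d2f <-] := d2; exact: deriveB.
  have [||a ah E1] := @mean_value_derive _ _ phi x v' h => //.
    by move=> c /dphi[].
  have [||b bh E2] := @mean_value_derive _ _ ('D_v' f) (x + a *: v') w' h => //.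
    by move=> c ch; apply: diff_derivable (df a c ah ch).2.
  exists a, b; split => //; rewrite -E2.
  have [_ <-] := dphi a ah; rewrite -E1 /phi.
  by rewrite opprB addrA [RHS]addrAC.
apply/eqP; rewrite -subr_eq0 -normr_le0; apply/ler_addgt0Pl => e e0; rewrite addr0.
have e2 : 0 < e / 2 by rewrite divr_gt0.
have /cvgrPdist_lt/(_ _ e2)/nbhs_ballP[d1 /= d10 h1] := Cv.2 w.
have /cvgrPdist_lt/(_ _ e2)/nbhs_ballP[d2 /= d20 h2] := Cw.2 v.
pose h := (Num.min d (Num.min d1 d2)) / s / 2.
have h0 : 0 < h by rewrite !divr_gt0// !lt_min d0 d10.
have hs : h < Num.min d (Num.min d1 d2) / s.
  by rewrite /h ltr_pdivrMr// ltr_pMr ?divr_gt0 ?lt_min ?d0 ?d10//; lra.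
have hlt d' : Num.min d (Num.min d1 d2) <= d' -> 0 < h < d' / s.
  by move=> md; rewrite h0 (lt_le_trans hs)// ler_wpM2r// invr_ge0 ltW.
have hd0 : 0 < h < d / s by apply: hlt; rewrite ge_min lexx.
have hd1 : 0 < h < d1 / s by apply: hlt; rewrite !ge_min lexx !orbT.
have hd2 : 0 < h < d2 / s by apply: hlt; rewrite !ge_min lexx !orbT.
clearbody h.
have [|a [b [ah bh E1]]] := diff2 v w h h0.
  by move=> a b ah bh; have [] := hd _ (near_lt _ _ _ _ d0 hd0 ah bh).
have [|a' [b' [ah' bh' E2]]] := diff2 w v h h0.
  move=> a' b' ah' bh'; rewrite addrAC.
  by have [] := hd _ (near_lt _ _ _ _ d0 hd0 bh' ah').
have hn0 : h != 0 by rewrite gt_eqF.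
(* The second difference is symmetric in [v] and [w], so the two evaluations agree and [h] cancels
   twice. The two points differ, but each lies where its mixed derivative is within [e / 2] of the
   value at [x]. *)
have E : 'D_w ('D_v f) (x + a *: v + b *: w) = 'D_v ('D_w f) (x + b' *: v + a' *: w).
  rewrite [x + h *: w + _]addrAC [x + a' *: w + _]addrAC in E2.
  rewrite [X in X + _]addrAC E1 in E2.
  exact/(mulIf hn0)/(mulIf hn0).
have /= n1 := h1 (x + a *: v + b *: w).
have /= n2 := h2 (x + b' *: v + a' *: w).
rewrite -ball_normE /= distrC in n1; rewrite -ball_normE /= distrC in n2.
have {}n1 := n1 (near_lt _ _ _ _ d10 hd1 ah bh).
have {}n2 := n2 (near_lt _ _ _ _ d20 hd2 bh' ah').
rewrite E in n1.
rewrite (_ : _ - _ = ('D_w ('D_v f) x - 'D_v ('D_w f) (x + b' *: v + a' *: w)) -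
  ('D_v ('D_w f) x - 'D_v ('D_w f) (x + b' *: v + a' *: w))); last by rewrite opprB addrA subrK.
apply: le_trans (ler_normB _ _) _; rewrite [leRHS]splitr.
exact: (lerD (ltW n1) (ltW n2)).
Qed.

Lemma smooth_on_C1 (V : normedModType R) (D : set V) (f : V -> R^o) x :
  open D -> smooth_on D f -> D x -> C1_at (f : V -> R) x.
Proof.
move=> oD sf Dx; have [df cf] := sf 1.
split; first by apply: filterS (open_nbhs_nbhs (conj oD Dx)) => z /df.
by move=> v; exact: cf.
Qed.

Lemma smooth_on_derive (V W : normedModType R) (D : set V) (f : V -> W) v :
  smooth_on D f -> smooth_on D ('D_v f).
Proof. by move=> sf k; have [_ ] := sf k.+1; exact. Qed.

Lemma smooth_on_mx_C1 (V : normedModType R) (D : set V) m p (f : V -> 'M[R]_(m, p)) x i j :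
  open D -> smooth_on D f -> D x -> C1_at (fun y => f y i j) x.
Proof.
move=> oD sf Dx; have [df cf] := sf 1.
have Dn : \forall z \near x, D z by exact: open_nbhs_nbhs.
split.
  apply: filterS Dn => z /df dz.
  apply: (@differentiable_comp _ _ _ _ f (fun M : 'M[R]_(m, p) => M i j)) => //.
  exact: differentiable_coord.
move=> v; apply: (@near_eq_continuous _ _ (fun z => 'D_v f z i j)).
  apply: filterS Dn => z /df/(@diff_derivable _ _ _ _ _ v) dz.
  by rewrite derive_mx// mxE.
apply: (@continuous_comp _ _ _ ('D_v f) (fun M : 'M[R]_(m, p) => M i j)); first exact: cf.
exact: coord_continuous.
Qed.

Lemma C1_coord m p (x : 'M[R]_(m, p)) i j : C1_at (fun z : 'M[R]_(m, p) => z i j) x.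
Proof.
split; first by apply/nbhs_ballP; exists 1 => //= z _; exact: differentiable_coord.
move=> v; rewrite (_ : 'D_v _ = cst (v i j)); first exact: cst_continuous.
apply/funext => z.
have /matrixP/(_ i j) : 'D_v id z = v by exact: derive_id.
by rewrite derive_mx ?mxE//; exact: derivable_id.
Qed.

End C1_at.

(** * Charts and bump functions *)

Section bump.
Context (R : realType).
Implicit Types s : R.

Definition sqpos s : R := Num.max 0 s ^+ 2.

Lemma sqpos_derive s : is_derive s 1 sqpos (2 * Num.max 0 s).
Proof.
have [s0|s0|<-] := ltgtP 0 s.
- have E : \near s, s ^+ 2 = sqpos s.
    near=> t; have t0 : 0 < t by near: t; exact: lt_nbhsr.
    by rewrite /sqpos max_r// ltW.
  apply: near_eq_is_derive E _.
  split; first exact: exprn_derivable.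
  by rewrite exp_derive expr1 /GRing.scale /= mulr1.
- have E : \near s, cst 0 s = sqpos s.
    near=> t; have t0 : t < 0 by near: t; exact: lt_nbhsl.
    by rewrite /sqpos max_l ?expr0n// ltW.
  apply: near_eq_is_derive E _.
  by split; [exact: derivable_cst|rewrite derive_cst mulr0].
rewrite mulr0.
(* At the junction point 0 the difference quotient is [Num.max 0 h], which tends to 0. *)
have E : h^-1 *: ((sqpos \o shift 0) (h *: (1 : R)) - sqpos 0) @[h --> (0 : R)^'] --> (0 : R).
  apply: (@cvg_trans _ ((Num.max 0 h) @[h --> (0 : R)^'])).
    apply: near_eq_cvg; near=> h.
    have h0 : h != 0 by near: h; exact: nbhs_dnbhs_neq.
    rewrite /= /sqpos addr0 maxxx expr0n subr0 /GRing.scale /= mulr1.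
    have [|] := leP 0 h; first by rewrite expr2 mulrA mulVf// mul1r.
    by rewrite expr0n mulr0.
  have : Num.max 0 h @[h --> (0 : R)] --> Num.max (0 : R) 0.
    by apply: continuous_max; [exact: cvg_cst|exact: cvg_id].
  by rewrite maxxx; exact: cvg_within_filter.
split; first by apply/cvg_ex; exists 0.
by apply/cvg_lim.
Unshelve. all: end_near. Qed.

(* Half the second difference of max(0, s)^2, hence C^1 and constant off [0, 2]. *)
Definition bump1 s : R := (sqpos s - 2 * sqpos (s - 1) + sqpos (s - 2)) / 2.

Lemma bump1_le0 s : s <= 0 -> bump1 s = 0.
Proof.
move=> s0; rewrite /bump1 /sqpos !max_l ?expr0n; first lra.
all: lra.
Qed.

Lemma bump1_ge2 s : 2 <= s -> bump1 s = 1.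
Proof.
move=> s0; rewrite /bump1 /sqpos !max_r; first by field.
all: lra.
Qed.

Lemma bump1_ge0 s : 0 <= bump1 s.
Proof.
have [s0|s0] := leP s 0; first by rewrite bump1_le0.
have [s2|s2] := leP 2 s; first by rewrite bump1_ge2.
rewrite /bump1 /sqpos divr_ge0// (max_l (_ : s - 2 <= 0)) ?(max_r (ltW s0)); last lra.
have [s1|s1] := leP 0 (s - 1); nra.
Qed.

Lemma bump1_derive s : is_derive s 1 bump1
  (Num.max 0 s - 2 * Num.max 0 (s - 1) + Num.max 0 (s - 2)).
Proof.
have sh (c : R) : is_derive s 1 (fun t => sqpos (t - c)) (2 * Num.max 0 (s - c)).
  have [E1 E2] : (derivable (fun t => sqpos (t - c)) s 1 <-> derivable sqpos (s - c) 1) /\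
     'D_1 (fun t => sqpos (t - c)) s = 'D_1 sqpos (s - c).
    by apply: derive_along => h; rewrite addrA.
  have [d1 d2] := sqpos_derive (s - c).
  by split; [exact/E1|rewrite E2].
have s0 := sqpos_derive s; have s1 := sh 1; have s2 := sh 2.
rewrite /bump1.
apply: is_derive_eq.
rewrite scaler0 scaler0 add0r /GRing.scale /=.
by move: (Num.max 0 s) (Num.max 0 (s - 1)) (Num.max 0 (s - 2)) => a b c; field.
Qed.

Lemma bump1_derive1_continuous : continuous (derive1 bump1).
Proof.
rewrite (_ : derive1 bump1 =
    fun s => Num.max 0 s - 2 * Num.max 0 (s - 1) + Num.max 0 (s - 2)); last first.
  by apply/funext => s; rewrite derive1E; have [] := bump1_derive s.
have cm (c : R) : continuous (fun s : R => Num.max 0 (s - c)).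
  move=> s; apply: (@continuous_max _ _ (cst 0) (fun s => s - c)); first exact: cvg_cst.
  by apply: cvgB; [exact: cvg_id|exact: cvg_cst].
move=> s; apply: cvgD; last exact: cm.
apply: cvgB; last by apply: cvgMr; exact: cm.
by apply: (@continuous_max _ _ (cst 0) id); [exact: cvg_cst|exact: cvg_id].
Qed.

End bump.

Section charts.
Context (R : realType) (n : nat) (M : ptopologicalType) (A : smooth_atlas R n M).
Implicit Types (i j : chart_index A) (f h : M -> R) (x : M) (y : 'rV[R]_n).

Lemma chart_im_map i x : chart_dom i x -> chart_im i (chart_map i x).
Proof. by move=> dx; exists x. Qed.

Lemma chart_im_dom i y : chart_im i y -> chart_dom i (chart_inv i y).
Proof. by move=> [x dx <-]; rewrite chart_mapK. Qed.

Lemma chart_invK i y : chart_im i y -> chart_map i (chart_inv i y) = y.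
Proof. by move=> [x dx <-]; rewrite chart_mapK. Qed.

Lemma near_chart_im i y : chart_im i y -> \forall z \near y, chart_im i z.
Proof. by move=> iy; apply: open_nbhs_nbhs; split => //; exact: chart_im_open. Qed.

Lemma near_chart_dom i x : chart_dom i x -> \forall z \near x, chart_dom i z.
Proof. by move=> dx; apply: open_nbhs_nbhs; split => //; exact: chart_dom_open. Qed.

Lemma near_chart_inv i y (P : set M) : chart_im i y ->
  nbhs (chart_inv i y) P -> \forall z \near y, P (chart_inv i z).
Proof. by move=> iy; exact: (chart_inv_continuous iy). Qed.

Lemma near_chart_map i x (P : set 'rV[R]_n) : chart_dom i x ->
  nbhs (chart_map i x) P -> \forall z \near x, P (chart_map i z).
Proof. by move=> dx; exact: (chart_map_continuous dx). Qed.

Lemma near_chart_invE i x (P : set M) : chart_dom i x ->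
  nbhs x P -> \forall z \near chart_map i x, P (chart_inv i z).
Proof.
by move=> dx Px; apply: near_chart_inv; rewrite ?chart_mapK//; exact: chart_im_map.
Qed.

Lemma continuous_in_chart i x h : chart_dom i x ->
  {for chart_map i x, continuous (h \o chart_inv i)} -> {for x, continuous h}.
Proof.
move=> dx ch.
apply: (@near_eq_continuous _ _ ((h \o chart_inv i) \o chart_map i)).
  by apply: filterS (near_chart_dom dx) => z dz /=; rewrite chart_mapK.
by apply: continuous_comp => //; exact: chart_map_continuous.
Qed.

Definition chart_overlap i j : set 'rV[R]_n := chart_map i @` (chart_dom i `&` chart_dom j).

Lemma chart_overlapP i j y : chart_overlap i j y <->
  chart_im i y /\ chart_dom j (chart_inv i y).
Proof.
split=> [[x [dx dy] <-]|[iy jy]].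
  by rewrite chart_mapK//; split => //; exact: chart_im_map.
by exists (chart_inv i y); [split => //; exact: chart_im_dom|exact: chart_invK].
Qed.

Lemma chart_overlap_open i j : open (chart_overlap i j).
Proof.
rewrite openE => y /chart_overlapP[iy jy].
apply: filterS2 (near_chart_im iy) (near_chart_inv iy (near_chart_dom jy)) => z iz jz.
exact/chart_overlapP.
Qed.

Lemma near_chart_overlap i j y : chart_overlap i j y ->
  \forall z \near y, chart_overlap i j z.
Proof. by move=> oy; apply: open_nbhs_nbhs; split => //; exact: chart_overlap_open. Qed.

Definition C1_on_charts f := forall i y, chart_im i y -> C1_at (f \o chart_inv i) y.

Lemma smooth_C1_on_charts f : smooth A f -> C1_on_charts f.
Proof. by move=> sf i y iy; apply: smooth_on_C1 (sf i) iy; exact: chart_im_open. Qed.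

Lemma C1_on_charts_continuous f : C1_on_charts f -> continuous f.
Proof.
move=> Cf x; apply: continuous_in_chart (chart_atP A x) _.
by apply: C1_continuous; apply: Cf; apply: chart_im_map; exact: chart_atP.
Qed.

Lemma C1_on_charts_cst (c : R) : C1_on_charts (fun=> c).
Proof. by move=> i y _; exact: C1_cst. Qed.

Lemma C1_on_chartsM f h : C1_on_charts f -> C1_on_charts h ->
  C1_on_charts (fun x => f x * h x).
Proof. by move=> Cf Ch i y iy; exact: (C1M (Cf i y iy) (Ch i y iy)). Qed.

Lemma C1_on_chartsB f h : C1_on_charts f -> C1_on_charts h ->
  C1_on_charts (fun x => f x - h x).
Proof. by move=> Cf Ch i y iy; exact: (C1B (Cf i y iy) (Ch i y iy)). Qed.

(** A [vector_field] may have unrelated components in different charts; the second clause is the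
    transformation law that makes them one tangent vector field. *)
Definition C1_field (X : vector_field A) :=
  (forall i k y, chart_im i y -> C1_at (fun z => X i z 0 k) y) /\
  (forall i j y, chart_overlap i j y ->
     X j (chart_map j (chart_inv i y)) = 'd (chart_map j \o chart_inv i) y (X i y)).

Definition field_derive (X : vector_field A) i f y : R :=
  \sum_(k < n) partial k (f \o chart_inv i) y * X i y 0 k.

Lemma sum_partial (F : 'rV[R]_n -> R) (y v : 'rV[R]_n) : differentiable F y ->
  \sum_(k < n) partial k F y * v 0 k = 'd F y v.
Proof.
move=> dF; rewrite [in RHS](row_sum_delta v) linear_sum; apply: eq_bigr => k _.
by rewrite linearZ /= mulrC /partial deriveE.
Qed.

Lemma transition_differentiable i j y : chart_overlap i j y ->
  differentiable (chart_map j \o chart_inv i) y.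
Proof. by move=> oy; have [d _] := chart_transition_smooth i j 1; exact: d. Qed.

Lemma diff_transition i j f y : C1_on_charts f -> chart_overlap i j y -> forall v,
  'd (f \o chart_inv i) y v =
  'd (f \o chart_inv j) (chart_map j (chart_inv i y)) ('d (chart_map j \o chart_inv i) y v).
Proof.
move=> Cf oy v; have [iy jy] := (chart_overlapP i j y).1 oy.
have jm := chart_im_map jy.
have E : \forall z \near y, (f \o chart_inv i) z = ((f \o chart_inv j) \o (chart_map j \o chart_inv i)) z.
  apply: filterS (near_chart_overlap oy) => z /chart_overlapP[_ jz].
  by rewrite /= chart_mapK.
have d1 := transition_differentiable oy.
have d2 : differentiable (f \o chart_inv j) (chart_map j (chart_inv i y)).
  exact/C1_differentiable/Cf.
have d3 : differentiable (f \o chart_inv i) y by exact/C1_differentiable/Cf.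
have d4 : differentiable ((f \o chart_inv j) \o (chart_map j \o chart_inv i)) y.
  exact: differentiable_comp.
apply: etrans (esym (deriveE v d3)) _; apply: etrans (near_eq_derive v E) _.
apply: etrans (deriveE v d4) _.
exact: (congr1 (fun F : 'rV[R]_n -> R => F v) (diff_comp d1 d2)).
Qed.

Lemma field_derive_chart (X : vector_field A) f i j x : C1_field X -> C1_on_charts f ->
  chart_dom i x -> chart_dom j x ->
  field_derive X i f (chart_map i x) = field_derive X j f (chart_map j x).
Proof.
move=> [_ cX] Cf ix jx.
have iy := chart_im_map ix; have jy := chart_im_map jx.
have oy : chart_overlap i j (chart_map i x) by exists x.
rewrite /field_derive !sum_partial; try exact/C1_differentiable/Cf.
have <- : chart_map j (chart_inv i (chart_map i x)) = chart_map j x by rewrite chart_mapK.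
apply: etrans (diff_transition Cf oy _) _.
exact: (congr1 ('d (f \o chart_inv j) _) (esym (cX _ _ _ oy))).
Qed.

(** Squared Euclidean distance instead of the matrix norm: it is a polynomial in the coordinates,
    hence C^1, whereas the maximum norm has corners. *)
Definition sqdist (y0 y : 'rV[R]_n) : R := \sum_(k < n) (y 0 k - y0 0 k) ^+ 2.

Lemma sqdist_le (y0 y : 'rV[R]_n) (r : R) : 0 <= r ->
  sqdist y0 y <= r ^+ 2 -> `|y0 - y| <= r.
Proof.
move=> r0 h; apply/mx_norm_leP => // i k; rewrite (ord1 i) !mxE distrC.
rewrite -ler_sqr ?nnegrE// real_normK ?num_real//; apply: le_trans h.
by rewrite /sqdist (bigD1 k)//= lerDl sumr_ge0// => l _; exact: sqr_ge0.
Qed.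

Lemma sqdist_continuous (y0 : 'rV[R]_n) : continuous (sqdist y0).
Proof.
move=> y; apply: C1_continuous; apply: C1_sum => k _; rewrite /=.
have Ck : C1_at (fun z : 'rV[R]_n => z 0 k - y0 0 k) y.
  by apply: C1B; [exact: C1_coord|exact: C1_cst].
under eq_fun do rewrite expr2.
exact: C1M.
Qed.

(** In a Hausdorff space [K] is closed, so off [K] the function is zero on a neighbourhood;
    regularity remains to be checked at points of [K]. *)
Lemma C1_on_charts_zero f (K : set M) : compact K -> (forall x, ~ K x -> f x = 0) ->
  (forall x, K x -> forall i, chart_dom i x -> C1_at (f \o chart_inv i) (chart_map i x)) ->
  C1_on_charts f.
Proof.
move=> cK f0 Cf i y iy.
have [Kx|nKx] := pselect (K (chart_inv i y)).
  by rewrite -[y](chart_invK iy); apply: Cf => //; exact: chart_im_dom.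
have cl : closed K by apply: compact_closed => //; exact: atlas_hausdorff A.
apply: C1_near_eq (C1_cst 0 y).
have nK : nbhs (chart_inv i y) (~` K) by apply: open_nbhs_nbhs; split => //; exact: closed_openC.
by apply: filterS (near_chart_inv iy nK) => z nKz; rewrite /= f0.
Qed.

(** The bump is [bump1 (4 - c * sqdist y0 y)] read in the preferred chart and extended by 0. Besides
    a support inside a given neighbourhood it has a plateau [V] where it equals 1, which later
    serves to peel off pieces of a function. *)
Lemma chart_bump x (U : set M) : nbhs x U -> exists (psi : M -> R) (K V : set M),
  [/\ C1_on_charts psi, compact K, K `<=` U `&` chart_dom (chart_at A x) &
    [/\ (forall z, ~ K z -> psi z = 0), nbhs x V, (forall z, V z -> psi z = 1) &
        forall z, 0 <= psi z]].
Proof.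
move=> Ux; set i := chart_at A x; have ix : chart_dom i x := chart_atP A x.
set y0 := chart_map i x.
have iy0 : chart_im i y0 by exact: chart_im_map.
have /nbhs_ballP[r /= r0 hr] : \forall y \near y0, chart_im i y /\ U (chart_inv i y).
  by apply: filterS2 (near_chart_im iy0) (near_chart_invE ix Ux).
have r20 : 0 < r / 2 by rewrite divr_gt0.
pose B := [set y | sqdist y0 y <= (r / 2) ^+ 2].
have Br y : B y -> chart_im i y /\ U (chart_inv i y).
  move=> By; apply: hr; rewrite -ball_normE /=.
  by apply: le_lt_trans (sqdist_le (ltW r20) By) _; lra.
have cB : compact B.
  apply: bounded_closed_compact.
    exists (`|y0| + r / 2); split; first exact: num_real.
    move=> s ls y By; apply: ltW; apply: le_lt_trans ls.
    rewrite -lerBlDl; apply: le_trans (sqdist_le (ltW r20) By).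
    by rewrite distrC lerB_dist.
  rewrite (_ : B = sqdist y0 @^-1` [set s | s <= (r / 2) ^+ 2])//.
  by apply: closed_comp => [y _|]; [exact: sqdist_continuous|exact: closed_le].
(* With this [c], [arg] is negative outside the ball of radius [r / 2], where [bump1] gives 0, and
   at least 2 where [c * sqdist y0 y <= 2], where [bump1] gives 1. *)
pose c := 4 / (r / 2) ^+ 2.
have c0 : 0 < c by rewrite divr_gt0 ?exprn_gt0.
pose arg y := 4 - c * sqdist y0 y.
pose psi z := if z \in chart_dom i then bump1 (arg (chart_map i z)) else 0.
pose K := chart_inv i @` B.
have psi0 z : ~ K z -> psi z = 0.
  rewrite /psi; case: ifPn => // /set_mem iz nK; apply: bump1_le0.
  rewrite /arg subr_le0 -ler_pdivrMl// /c invf_div divfK ?pnatr_eq0//.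
  rewrite leNgt; apply: contra_notN nK => /ltW h.
  by exists (chart_map i z) => //; exact: chart_mapK.
have cK : compact K.
  apply: continuous_compact => //; apply: continuous_in_subspaceT => y.
  by rewrite inE => /Br[iy _]; exact: chart_inv_continuous.
exists psi, K, [set z | chart_dom i z /\ c * sqdist y0 (chart_map i z) < 2].
split; [|by []| |split].
- apply: (C1_on_charts_zero cK psi0) => z [y By yz] j jz.
  have iz : chart_dom i z by rewrite -yz; apply: chart_im_dom; have [] := Br y By.
  have oz : chart_overlap j i (chart_map j z) by exists z.
  apply: (@C1_near_eq _ _ (fun w => bump1 (arg ((chart_map i \o chart_inv j) w)))).
    apply: filterS (near_chart_overlap oz) => w /chart_overlapP[_ iw].
    by rewrite /psi /= mem_set.
  apply: (@C1_comp1 _ _ (@bump1 R) (fun w => arg ((chart_map i \o chart_inv j) w))).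
  + by move=> s; have [] := bump1_derive s.
  + exact: bump1_derive1_continuous.
  apply: C1B; first exact: C1_cst.
  apply: C1M; first exact: C1_cst.
  apply: C1_sum => k _.
  have Ck : C1_at (fun w => (chart_map i \o chart_inv j) w 0 k - y0 0 k) (chart_map j z).
    apply: C1B; last exact: C1_cst.
    apply: (@smooth_on_mx_C1 _ _ (chart_overlap j i) _ _ (chart_map i \o chart_inv j)) => //.
      exact: chart_overlap_open.
    exact: chart_transition_smooth.
  by under eq_fun do rewrite expr2; exact: C1M.
- move=> z [y /Br[iy Uy] <-]; split => //; exact: chart_im_dom.
- by [].
- have cx : \forall y \near chart_map i x, c * sqdist y0 y < 2.
    have cc : {for y0, continuous (fun y => c * sqdist y0 y)}.
      apply: (@continuousM _ _ (cst c) (sqdist y0)); first exact: cst_continuous.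
      exact: sqdist_continuous.
    have : c * sqdist y0 y0 < 2; last by move/lt_nbhsl; exact: cc.
    by rewrite /sqdist big1 ?mulr0// => k _; rewrite subrr expr0n.
  apply: filterS2 (near_chart_dom ix) (near_chart_map ix cx) => z iz hz; exact: conj.
- by move=> z [iz hz]; rewrite /psi mem_set//; apply: bump1_ge2; rewrite /arg; lra.
- by move=> z; rewrite /psi; case: ifP => // _; exact: bump1_ge0.
Qed.

End charts.

(** * Integration in a chart *)

Lemma sum_continuous_at (R : realType) (T : topologicalType) (I : Type) (r : seq I)
    (F : I -> T -> R) x : (forall i, {for x, continuous (F i)}) ->
  {for x, continuous (fun y => \sum_(i <- r) F i y)}.
Proof.
move=> cF; rewrite /prop_for; elim: r => [|i r IH].
  rewrite (_ : (fun y => _) = cst 0); first exact: cst_continuous.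
  by apply/funext => y; rewrite big_nil.
rewrite (_ : (fun y => _) = F i \+ (fun y => \sum_(j <- r) F j y)); last first.
  by apply/funext => y; rewrite big_cons.
exact: (@continuousD _ _ _ (F i) (fun y => \sum_(j <- r) F j y) x (cF i) IH).
Qed.

Lemma near_restrict_in (T : topologicalType) (R : realType) (G : T -> R) (D : set T) x :
  open D -> D x -> {near x, G =1 G \_ D}.
Proof.
move=> oD Dx; apply: filterS (open_nbhs_nbhs (conj oD Dx)) => z Dz.
by rewrite patchE mem_set.
Qed.

Lemma near_restrict_out (T : topologicalType) (R : realType) (G : T -> R) (D K : set T) x :
  closed K -> (forall x, D x -> ~ K x -> G x = 0) -> ~ K x ->
  {near x, (fun=> 0) =1 G \_ D}.
Proof.
move=> cK G0 nK; have oK : open (~` K) by exact: closed_openC.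
apply: filterS (open_nbhs_nbhs (conj oK nK)) => z nKz.
by rewrite patchE; case: ifPn => // /set_mem Dz; rewrite G0.
Qed.

(** Extension by zero: every point lies in the open set [D] or off the closed set [K], and near a
    point off [K] the extension is constantly 0. *)
Lemma continuous_restrict (T : topologicalType) (R : realType) (G : T -> R) (D K : set T) :
  open D -> closed K -> K `<=` D -> (forall x, D x -> ~ K x -> G x = 0) ->
  (forall x, D x -> {for x, continuous G}) -> continuous (G \_ D).
Proof.
move=> oD cK KD G0 cG x; have [Dx|nDx] := pselect (D x).
  exact: near_eq_continuous (near_restrict_in _ oD Dx) (cG x Dx).
apply: (near_eq_continuous (near_restrict_out cK G0 _)); last exact: cst_continuous.
by move=> /KD.
Qed.

(** The radius [B] is chosen before [F]: it depends on [K] alone, so it serves all partial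
    derivatives in a sum at once. *)
Lemma compact_test_fun (R : realType) n (K : set 'rV[R]_n) : compact K ->
  exists2 B, 0 <= B & forall F : 'rV[R]_n -> R, continuous F ->
    (forall y, ~ K y -> F y = 0) -> exists S, test_fun B S F.
Proof.
move=> cK; have [B0 [_ hB]] := compact_bounded cK.
exists (Num.max 0 B0 + 1); first by rewrite addr_ge0// le_max lexx.
move=> F cF F0.
have /compact_bounded[S0 [_ hS]] : compact (F @` K).
  by apply: continuous_compact => //; exact: continuous_subspaceT.
exists (Num.max 0 S0 + 1); split => // y.
  move=> By; apply: F0 => Ky; have lB : B0 < Num.max 0 B0 + 1.
    by rewrite ltr_pwDr// le_max lexx orbT.
  by have := le_lt_trans (hB _ lB y Ky) By; rewrite ltxx.
have [Ky|nKy] := pselect (K y); last by rewrite F0// normr0 addr_ge0// le_max lexx.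
apply: (hS (Num.max 0 S0 + 1)); last by exists y.
by rewrite ltr_pwDr// le_max lexx orbT.
Qed.

Lemma continuous_borel_measurable (R : realType) (M : ptopologicalType) (h : M -> R) :
  continuous h -> measurable_fun [set: borel M] h.
Proof.
move=> ch; apply: (measurability _ (RGenOInfty.measurableE R)) => //.
move=> _ [_ [x ->] <-]; rewrite setTI; apply: sub_sigma_algebra.
by apply: open_comp => // z _; exact: ch.
Qed.

Section chart_integration.
Context (R : realType) (n : nat) (M : ptopologicalType) (A : smooth_atlas R n M)
  (mu : volume_form A).
Implicit Types (i j : chart_index A) (f h : M -> R) (x : M) (y : 'rV[R]_n).

Lemma compact_closed_atlas (K : set M) : compact K -> closed K.
Proof. by apply: compact_closed; exact: atlas_hausdorff A. Qed.

Lemma chart_map_compact i (K : set M) : compact K -> K `<=` chart_dom i ->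
  compact (chart_map i @` K) /\ chart_map i @` K `<=` chart_im i.
Proof.
move=> cK Ki; split; last by move=> _ [x /Ki ix <-]; exact: chart_im_map.
apply: continuous_compact => //; apply: continuous_in_subspaceT => x.
by rewrite inE => /Ki; exact: chart_map_continuous.
Qed.

Lemma rV_compact_closed (K : set 'rV[R]_n) : compact K -> closed K.
Proof. by apply: compact_closed; exact: norm_hausdorff. Qed.

Definition pullback i h : 'rV[R]_n -> R :=
  (fun y => h (chart_inv i y) * vf_dens mu i y) \_ (chart_im i).

Lemma vf_dens_C1 i y : chart_im i y -> C1_at (vf_dens mu i) y.
Proof.
by move=> iy; apply: smooth_on_C1 (vf_dens_smooth mu i) iy; exact: chart_im_open.
Qed.

Lemma vf_dens_neq0 i y : chart_im i y -> vf_dens mu i y != 0.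
Proof. by move=> iy; rewrite gt_eqF//; exact: vf_dens_gt0. Qed.

Lemma off_chart_image i (K : set M) y : chart_im i y -> ~ (chart_map i @` K) y ->
  ~ K (chart_inv i y).
Proof. by move=> iy nK Ky; apply: nK; exists (chart_inv i y) => //; exact: chart_invK. Qed.

Lemma pullback_test_fun i h (K : set M) : continuous h -> compact K ->
  K `<=` chart_dom i -> (forall x, ~ K x -> h x = 0) ->
  exists B S, 0 <= B /\ test_fun B S (pullback i h).
Proof.
move=> ch cK Ki h0; have [cK' Ki'] := chart_map_compact cK Ki.
have [B B0 hB] := compact_test_fun cK'.
have G0 y : chart_im i y -> ~ (chart_map i @` K) y -> h (chart_inv i y) * vf_dens mu i y = 0.
  by move=> iy nK; rewrite h0 ?mul0r//; exact: off_chart_image nK.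
have [||S hS] := hB (pullback i h); last by exists B, S.
  apply: (continuous_restrict (@chart_im_open _ _ _ _ i) (rV_compact_closed cK') Ki' G0) => y iy.
  apply: (@continuousM _ _ (h \o chart_inv i) (vf_dens mu i)).
    by apply: continuous_comp; [exact: chart_inv_continuous|exact: ch].
  exact: C1_continuous (vf_dens_C1 iy).
by move=> y nK; rewrite /pullback patchE; case: ifPn => // /set_mem iy; exact: G0.
Qed.

(** [vf_densE] covers nonnegative functions over one chart domain; a support inside that domain
    turns it into an integral over [M]. *)
Lemma integral_chart_ge0 i h (K : set M) : continuous h -> compact K ->
  K `<=` chart_dom i -> (forall x, ~ K x -> h x = 0) -> (forall x, 0 <= h x) ->
  (\int[mu]_(x in [set: borel M]) (h x)%:E = (iint (pullback i h))%:E)%E.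
Proof.
move=> ch cK Ki h0 hge.
have [B [S [B0 tS]]] := pullback_test_fun ch cK Ki h0.
have mh : measurable_fun [set: borel M] (EFin \o h).
  by apply/measurable_EFinP; exact: continuous_borel_measurable.
rewrite -(integral_rV_iint B0 tS).
have := vf_densE mu i mh (fun x => hge x).
rewrite integral_mkcond.
have -> : (EFin \o h) \_ (chart_dom i : set (borel M)) = EFin \o h.
  apply/funext => x; rewrite patchE; case: ifPn => // /negP nx /=; rewrite h0//.
  by move=> /Ki ix; apply: nx; exact/mem_set.
move=> ->; congr integral_rV; apply/funext => y.
by rewrite /pullback !patchE; case: ifP.
Qed.

Lemma integral_chart i h (K : set M) : continuous h -> compact K ->
  K `<=` chart_dom i -> (forall x, ~ K x -> h x = 0) ->
  mu.-integrable [set: borel M] (EFin \o h) /\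
  \int[mu]_(x in [set: borel M]) h x = iint (pullback i h).
Proof.
move=> ch cK Ki h0.
have part (g : M -> R) : continuous g -> (forall x, ~ K x -> g x = 0) -> (forall x, 0 <= g x) ->
    mu.-integrable [set: borel M] (EFin \o g) /\
    \int[mu]_(x in [set: borel M]) g x = iint (pullback i g).
  move=> cg g0 gge; have E := integral_chart_ge0 cg cK Ki g0 gge.
  split; last by rewrite /Rintegral E.
  apply/integrableP; split.
    by apply/measurable_EFinP; exact: continuous_borel_measurable.
  under eq_integral => x _ do rewrite /= (ger0_norm (gge x)).
  by rewrite E ltry.
pose hp x := Num.max (h x) 0; pose hn x := Num.max (- h x) 0.
have hE x : h x = hp x - hn x.
  by rewrite /hp /hn; have [|] := leP (h x) 0; have [|] := leP (- h x) 0; lra.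
have chp : continuous hp.
  by move=> x; apply: (@continuous_max _ _ h (cst 0)); [exact: ch|exact: cst_continuous].
have chn : continuous hn.
  move=> x; apply: (@continuous_max _ _ (fun x => - h x) (cst 0)); last exact: cst_continuous.
  by apply: (@continuousN _ _ _ h); exact: ch.
have hp0 x : ~ K x -> hp x = 0 by move=> nK; rewrite /hp h0// maxxx.
have hn0 x : ~ K x -> hn x = 0 by move=> nK; rewrite /hn h0// oppr0 maxxx.
have [ip Ep] : mu.-integrable [set: borel M] (EFin \o hp) /\
    \int[mu]_(x in [set: borel M]) hp x = iint (pullback i hp).
  by apply: part => // x; rewrite le_max lexx orbT.
have [in_ En] : mu.-integrable [set: borel M] (EFin \o hn) /\
    \int[mu]_(x in [set: borel M]) hn x = iint (pullback i hn).
  by apply: part => // x; rewrite le_max lexx orbT.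
split.
  rewrite (_ : EFin \o h = (EFin \o hp) \- (EFin \o hn))%E; first exact: integrableB.
  by apply/funext => x /=; rewrite -EFinB -hE.
under eq_Rintegral do rewrite hE.
rewrite RintegralB// Ep En.
have [B [S [B0 tS]]] := pullback_test_fun chn cK Ki hn0.
have [B' [S' [B'0 tS']]] := pullback_test_fun ch cK Ki h0.
have mB : 0 <= Num.max B B' by rewrite le_max B0.
have {}tS : test_fun (Num.max B B') S (pullback i hn) by apply: test_funW (lexx S) tS; rewrite le_max lexx.
have {}tS' : test_fun (Num.max B B') S' (pullback i h) by apply: test_funW (lexx S') tS'; rewrite le_max lexx orbT.
(* Written as a sum rather than a difference, so that [iintD] applies. *)
rewrite (_ : pullback i hp = pullback i h \+ pullback i hn).
  by rewrite (iintD mB tS' tS) addrK.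
apply/funext => y; rewrite /pullback /= !patchE; case: ifP => _; last by rewrite addr0.
by rewrite (hE (chart_inv i y)) -mulrDl subrK.
Qed.

Lemma integral_compact_support_eq0 i h (K : set M) : continuous h -> compact K ->
  K `<=` chart_dom i -> (forall x, ~ K x -> h x = 0) -> (forall x, 0 <= h x) ->
  \int[mu]_(x in [set: borel M]) h x = 0 -> forall x, h x = 0.
Proof.
move=> ch cK Ki h0 hge ih x; have [Kx|] := pselect (K x); last exact: h0.
have [B [S [B0 tS]]] := pullback_test_fun ch cK Ki h0.
have [_ E] := integral_chart ch cK Ki h0; rewrite ih in E.
have ix := Ki x Kx; have iy := chart_im_map ix.
have /(_ (chart_map i x)) : forall y, pullback i h y = 0.
  apply: (iint_eq0 B0 tS) => // y; rewrite /pullback patchE; case: ifPn => // /set_mem jy.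
  by rewrite mulr_ge0// ltW//; exact: vf_dens_gt0.
rewrite /pullback patchE mem_set// chart_mapK// => /eqP.
by rewrite mulf_eq0 (negbTE (vf_dens_neq0 iy)) orbF => /eqP.
Qed.

(** The divergence computed in one fixed chart. For a [C1_field] it is continuous on the chart
    domain, which is not evident for [divergence], whose chart changes with the point. *)
Definition chart_div i (X : vector_field A) x : R :=
  (\sum_(k < n) partial k (fun z => vf_dens mu i z * X i z 0 k) (chart_map i x))
    / vf_dens mu i (chart_map i x).

Lemma chart_div_continuous i X x : C1_field X -> chart_dom i x ->
  {for x, continuous (chart_div i X)}.
Proof.
move=> [CX _] ix; have iy := chart_im_map ix.
apply: (continuous_in_chart ix).
apply: (@near_eq_continuous _ _ (fun y =>
   (\sum_(k < n) partial k (fun z => vf_dens mu i z * X i z 0 k) y) / vf_dens mu i y)).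
  by apply: filterS (near_chart_im iy) => y jy; rewrite /chart_div /= chart_invK.
apply: (@continuousM _ _ (fun y => \sum_(k < n) partial k (fun z => vf_dens mu i z * X i z 0 k) y)
  (fun y => (vf_dens mu i y)^-1)).
  apply: (sum_continuous_at (F := fun k y => partial k (fun z => vf_dens mu i z * X i z 0 k) y)) => k.
  by have [_] := C1M (vf_dens_C1 iy) (CX i k _ iy); exact.
by apply: continuousV; [exact: vf_dens_neq0|exact: C1_continuous (vf_dens_C1 iy)].
Qed.

Lemma scale_field_C1 f X : C1_on_charts A f -> C1_field X -> C1_field (scale_field f X : vector_field A).
Proof.
move=> Cf [CX cX]; split=> [i k y iy|i j y oy].
  by under eq_fun do rewrite mxE; apply: C1M; [exact: Cf|exact: CX].
have [iy jy] := (chart_overlapP i j y).1 oy.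
rewrite /scale_field chart_mapK// cX//.
by rewrite [RHS]linearZ.
Qed.

(** Leibniz rule. The last term is free of the density and chart independent by
    [field_derive_chart], so it cancels when two charts are compared. *)
Lemma chart_div_scale i f X x : C1_on_charts A f -> C1_field X -> chart_dom i x ->
  chart_div i (scale_field f X) x =
  f x * chart_div i X x + field_derive X i f (chart_map i x).
Proof.
move=> Cf [CX _] ix; have iy := chart_im_map ix.
have d0 := vf_dens_neq0 iy.
rewrite /chart_div /field_derive.
have E k : partial k (fun z => vf_dens mu i z * scale_field f X i z 0 k) (chart_map i x) =
    f x * partial k (fun z => vf_dens mu i z * X i z 0 k) (chart_map i x) +
    vf_dens mu i (chart_map i x) * (partial k (f \o chart_inv i) (chart_map i x) * X i (chart_map i x) 0 k).
  have -> : (fun z => vf_dens mu i z * scale_field f X i z 0 k) =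
      (f \o chart_inv i) * (fun z => vf_dens mu i z * X i z 0 k).
    by apply/funext => z; rewrite mxE mulrCA.
  rewrite {1}/partial deriveM.
  - by rewrite /= chart_mapK// /partial /GRing.scale /=; ring.
  - exact/C1_derivable/Cf.
  - by apply: C1_derivable; apply: C1M; [exact: vf_dens_C1|exact: CX].
rewrite (eq_bigr _ (fun k _ => E k)) big_split /= -!mulr_sumr mulrDl mulrA.
by congr (_ + _); rewrite mulrAC divff// mul1r.
Qed.

Lemma chart_div_scale_near0 i f X x : chart_dom i x -> (\forall z \near x, f z = 0) ->
  chart_div i (scale_field f X) x = 0.
Proof.
move=> ix f0; rewrite /chart_div big1 ?mul0r// => k _.
transitivity ('D_(delta_mx 0 k) (cst (0 : R)) (chart_map i x)); last exact: derive_cst.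
apply: near_eq_derive; apply: filterS (near_chart_invE ix f0) => z /= fz.
by rewrite mxE fz mul0r mulr0.
Qed.

Lemma near_off_compact (K : set M) f x : compact K -> (forall x, ~ K x -> f x = 0) ->
  ~ K x -> \forall z \near x, f z = 0.
Proof.
move=> cK f0 nK; have oK : open (~` K) by apply: closed_openC; exact: compact_closed_atlas.
by apply: filterS (open_nbhs_nbhs (conj oK nK)) => z; exact: f0.
Qed.

(** The density in the denominator of [chart_div] cancels against the density of the pullback; what
    remains is a sum of partial derivatives of compactly supported C^1 functions, to which
    [iint_derive] applies. *)
Lemma chart_divergence_theorem i f X (K : set M) : C1_on_charts A f -> C1_field X ->
  compact K -> K `<=` chart_dom i -> (forall x, ~ K x -> f x = 0) ->
  [/\ continuous (chart_div i (scale_field f X) \_ (chart_dom i)),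
      (forall x, ~ K x -> (chart_div i (scale_field f X) \_ (chart_dom i)) x = 0) &
      \int[mu]_(x in [set: borel M]) (chart_div i (scale_field f X) \_ (chart_dom i)) x = 0].
Proof.
move=> Cf CX cK Ki f0; set h := _ \_ _.
have G0 x : chart_dom i x -> ~ K x -> chart_div i (scale_field f X) x = 0.
  by move=> ix nK; apply: chart_div_scale_near0 => //; exact: near_off_compact nK.
have ch : continuous h.
  apply: (continuous_restrict (@chart_dom_open _ _ _ _ i) (compact_closed_atlas cK) Ki G0) => x ix.
  by apply: chart_div_continuous => //; exact: scale_field_C1.
have h0 x : ~ K x -> h x = 0.
  by move=> nK; rewrite /h patchE; case: ifPn => // /set_mem ix; exact: G0.
split => //; have [_ ->] := integral_chart ch cK Ki h0.
have [cK' Ki'] := chart_map_compact cK Ki; have clK' := rV_compact_closed cK'.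
have [B B0 hB] := compact_test_fun cK'.
pose g k (y : 'rV[R]_n) := vf_dens mu i y * scale_field f X i y 0 k.
pose G k := g k \_ (chart_im i).
have Cg k y : chart_im i y -> C1_at (g k) y.
  move=> iy; apply: C1M; first exact: vf_dens_C1.
  by have [C _] := scale_field_C1 Cf CX; exact: C.
have g0 k y : chart_im i y -> ~ (chart_map i @` K) y -> g k y = 0.
  by move=> iy nK; rewrite /g mxE f0 ?mul0r ?mulr0//; exact: off_chart_image nK.
have G0' k y : ~ (chart_map i @` K) y -> G k y = 0.
  by move=> nK; rewrite /G patchE; case: ifPn => // /set_mem iy; exact: g0.
have CG k y : C1_at (G k) y.
  have [iy|niy] := pselect (chart_im i y).
    exact: C1_near_eq (near_restrict_in _ (@chart_im_open _ _ _ _ i) iy) (Cg k y iy).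
  apply: C1_near_eq (near_restrict_out clK' (g0 k) _) (C1_cst 0 y).
  by move=> /Ki'.
have DG0 k y : ~ (chart_map i @` K) y -> partial k (G k) y = 0.
  move=> nK; rewrite /partial -(near_eq_derive _ (near_restrict_out clK' (g0 k) nK)).
  exact: derive_cst.
have E : pullback i h = fun y => \sum_(k < n) partial k (G k) y.
  apply/funext => y; rewrite /pullback patchE; case: ifPn => [/set_mem iy|/negP niy].
    rewrite /h patchE mem_set; last exact: chart_im_dom.
    rewrite /chart_div chart_invK// divfK ?vf_dens_neq0//.
    apply: eq_bigr => k _; apply: near_eq_derive.
    exact: near_restrict_in (@chart_im_open _ _ _ _ i) iy.
  rewrite big1// => k _; apply: DG0 => Ky; apply: niy; exact/mem_set/Ki'.
have cDG k : continuous (partial k (G k)) by move=> y; exact: (CG k y).2.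
rewrite E (iint_sum _ B0); last by move=> k; apply: hB => //; exact: DG0.
rewrite big1// => k _.
have [S tS] : exists S, test_fun B S (G k).
  by apply: hB => //; [move=> y; exact: C1_continuous (CG k y)|exact: G0'].
have [S' tS'] : exists S, test_fun B S (partial k (G k)) by apply: hB => //; exact: DG0.
apply: (iint_derive (S := Num.max S S') B0).
- by apply: test_funW (lexx B) _ tS; rewrite le_max lexx.
- by move=> y; exact: C1_derivable (CG k y).
- by apply: test_funW (lexx B) _ tS'; rewrite le_max lexx orbT.
Qed.

End chart_integration.

(** * The divergence theorem *)

Section divergence_theorem.
Context (R : realType) (n : nat) (M : ptopologicalType) (A : smooth_atlas R n M)
  (mu : volume_form A).
Implicit Types (i j : chart_index A) (f h : M -> R) (x : M) (y : 'rV[R]_n) (X : vector_field A).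

(* Chart independence of the divergence without a change of variables formula:
   all the [chart_div i X] satisfy the same weak equation against bump
   functions. *)
Lemma chart_div_indep i j X x : C1_field X -> chart_dom i x -> chart_dom j x ->
  chart_div mu i X x = chart_div mu j X x.
Proof.
move=> CX ix jx; apply/eqP; rewrite -subr_eq0; apply: contraT => d0.
set d := chart_div mu i X x - chart_div mu j X x in d0.
pose D z := chart_div mu i X z - chart_div mu j X z.
(* Multiplying by [d], the value of [D] at [x], makes the discrepancy positive near [x] whatever its
   sign. *)
pose U := [set z | [/\ chart_dom i z, chart_dom j z & 0 < D z * d]].
have Ux : nbhs x U.
  have cD : {for x, continuous (fun z => D z * d)}.
    apply: (@continuousM _ _ D (cst d)); last exact: cst_continuous.
    by apply: (@continuousB _ _ _ (chart_div mu i X) (chart_div mu j X));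
      exact: chart_div_continuous.
  have : 0 < D x * d by rewrite -expr2 exprn_even_gt0.
  move/lt_nbhsr/(cD _) => h.
  by apply: filterS3 (near_chart_dom ix) (near_chart_dom jx) h => z.
have [psi [K [V [Cpsi cK KU [psi0 Vx psi1 psi_ge0]]]]] := chart_bump A Ux.
have Ki : K `<=` chart_dom i by move=> z /KU[[]].
have Kj : K `<=` chart_dom j by move=> z /KU[[]].
have [ci hi0 Ii] := chart_divergence_theorem mu Cpsi CX cK Ki psi0.
have [cj hj0 Ij] := chart_divergence_theorem mu Cpsi CX cK Kj psi0.
have [ini _] := integral_chart mu ci cK Ki hi0.
have [inj _] := integral_chart mu cj cK Kj hj0.
set hi := _ \_ (chart_dom i) in ci hi0 Ii ini; set hj := _ \_ (chart_dom j) in cj hj0 Ij inj.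
(* Both local divergences of the field scaled by [psi] integrate to 0 and their Leibniz terms agree,
   so [E] is the nonnegative function [psi * D * d] with integral 0. It must vanish, yet at [x] it
   equals [d ^+ 2]. *)
pose E z := (hi z - hj z) * d.
have EK z : K z -> E z = psi z * (D z * d).
  move=> Kz; have iz := Ki z Kz; have jz := Kj z Kz.
  rewrite /E /hi /hj !patchE !mem_set// !chart_div_scale//.
  by rewrite (field_derive_chart CX Cpsi iz jz) opprD addrACA subrr addr0 -mulrBr mulrA.
have E0 z : ~ K z -> E z = 0 by move=> nK; rewrite /E hi0// hj0// subrr mul0r.
have cE : continuous E.
  move=> z; apply: (@continuousM _ _ (fun z => hi z - hj z) (cst d)); last exact: cst_continuous.
  by apply: (@continuousB _ _ _ hi hj); [exact: ci|exact: cj].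
have Kx : K x.
  apply: contrapT => /psi0; rewrite (psi1 x (nbhs_singleton Vx)) => /eqP.
  by rewrite oner_eq0.
have : E x = 0.
  apply: (integral_compact_support_eq0 (mu := mu) cE cK Ki E0).
    move=> z; have [Kz|/E0 ->//] := pselect (K z).
    by rewrite EK// mulr_ge0//; have [[_ _ /ltW]] := KU z Kz.
  rewrite RintegralZr//; last first.
    by rewrite (_ : EFin \o _ = (EFin \o hi) \- (EFin \o hj))%E//; exact: integrableB.
  by rewrite RintegralB// Ii Ij subrr mul0r.
by rewrite EK// (psi1 x (nbhs_singleton Vx)) mul1r -[D x]/d => /eqP; rewrite mulf_eq0 orbb (negbTE d0).
Qed.

Lemma divergenceE i X x : C1_field X -> chart_dom i x ->
  divergence mu X x = chart_div mu i X x.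
Proof. by move=> CX ix; apply: chart_div_indep => //; exact: chart_atP. Qed.

(** Continuity at [x] is read in the one chart [chart_at x] on a whole neighbourhood, which chart
    independence permits. *)
Lemma divergence_continuous X : C1_field X -> continuous (divergence mu X).
Proof.
move=> CX x; have ix := chart_atP A x.
apply: (@near_eq_continuous _ _ (chart_div mu (chart_at A x) X)); last exact: chart_div_continuous.
by apply: filterS (near_chart_dom ix) => z iz; rewrite (divergenceE CX iz).
Qed.

Lemma divergence_scale f X x : C1_on_charts A f -> C1_field X ->
  divergence mu (scale_field f X) x = f x * divergence mu X x +
    field_derive X (chart_at A x) f (chart_map (chart_at A x) x).
Proof. by move=> Cf CX; exact: (chart_div_scale mu Cf CX (chart_atP A x)). Qed.

Lemma divergence_scaleD f h X x : C1_on_charts A f -> C1_on_charts A h -> C1_field X ->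
  divergence mu (scale_field (fun z => f z + h z) X) x =
  divergence mu (scale_field f X) x + divergence mu (scale_field h X) x.
Proof.
move=> Cf Ch CX; have iy := chart_im_map (chart_atP A x).
have Cfh : C1_on_charts A (fun z => f z + h z).
  by move=> i y jy; exact: (C1D (Cf i y jy) (Ch i y jy)).
rewrite !divergence_scale// /field_derive.
rewrite (eq_bigr (fun k => partial k (f \o chart_inv (chart_at A x)) (chart_map (chart_at A x) x) *
    X (chart_at A x) (chart_map (chart_at A x) x) 0 k +
  partial k (h \o chart_inv (chart_at A x)) (chart_map (chart_at A x) x) *
    X (chart_at A x) (chart_map (chart_at A x) x) 0 k)); last first.
  move=> k _; rewrite -mulrDl; congr (_ * _).
  by rewrite -deriveD//; apply: C1_derivable; [exact: Cf|exact: Ch].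
by rewrite big_split /= mulrDl addrACA.
Qed.

(** In place of a partition of unity, [f] is split as [psi f + (1 - psi) f] with one bump at a time:
    the first piece lives in a chart, the second vanishes on the plateau of that bump. *)
Lemma divergence_theorem f X (K : set M) : C1_on_charts A f -> C1_field X ->
  compact K -> (forall x, ~ K x -> f x = 0) ->
  mu.-integrable [set: borel M] (EFin \o divergence mu (scale_field f X)) /\
  \int[mu]_(x in [set: borel M]) divergence mu (scale_field f X) x = 0.
Proof.
move=> Cf CX cK f0.
have bump x : exists pKV : (M -> R) * set M * set M, let: (psi, L, V) := pKV in
    [/\ C1_on_charts A psi, compact L, L `<=` setT `&` chart_dom (chart_at A x) &
    [/\ (forall z, ~ L z -> psi z = 0), nbhs x V, (forall z, V z -> psi z = 1) &
        forall z, 0 <= psi z]].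
  by have [psi [L [V h]]] := @chart_bump R n M A x setT filterT; exists (psi, L, V).
have {bump}[pKV hp] := choice bump.
(* Interiors of the plateaus, since a finite subcover is extracted from open sets. *)
pose V x := (pKV x).2^°.
(* The induction is on a list of plateaus covering all points where [f] is nonzero; compactness of
   [K] provides the list. *)
suff claim (s : seq M) : forall f, C1_on_charts A f ->
    (forall z, f z != 0 -> exists2 x, x \in s & V x z) ->
    mu.-integrable [set: borel M] (EFin \o divergence mu (scale_field f X)) /\
    \int[mu]_(x in [set: borel M]) divergence mu (scale_field f X) x = 0.
  have : finite_subset_cover [set: M] V K.
    rewrite compact_cover in cK; apply: cK; first by move=> x _; exact: open_interior.
    move=> x Kx; exists x => //.
    have := hp x; rewrite /V; case: (pKV x) => [[psi L] W] /= [_ _ _ [_ xW _ _]].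
    exact: nbhs_singleton (nbhs_interior xW).
  move=> [s _ Ks]; apply: (claim (finmap.enum_fset s)) => // z fz.
  have [|x xs Vx] := Ks z; last by exists x.
  by apply: contrapT => /f0 /eqP; rewrite (negbTE fz).
elim: s => [|x s IH] {f0} {}f {}Cf fs.
  have E : divergence mu (scale_field f X) = cst 0.
    apply/funext => z; apply: chart_div_scale_near0; first exact: chart_atP.
    apply: nearW => w; apply/eqP; apply: contraT => /fs[].
    by move=> ? /[!inE].
  rewrite E; split; last by rewrite Rintegral_cst// mul0r.
  rewrite (_ : EFin \o _ = cst 0%E)//; exact: integrable0.
have := hp x; rewrite /V in fs IH *; case pE: (pKV x) => [[psi L] W] [Cpsi cL Li [psi0 xW psi1 _]].
have Ci : L `<=` chart_dom (chart_at A x) by move=> z /Li[].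
have Cfp : C1_on_charts A (fun z => psi z * f z) := C1_on_chartsM Cpsi Cf.
have C1psi : C1_on_charts A (fun z => 1 - psi z).
  by apply: C1_on_chartsB; [exact: C1_on_charts_cst|exact: Cpsi].
have Cfq : C1_on_charts A (fun z => (1 - psi z) * f z) := C1_on_chartsM C1psi Cf.
have fp0 z : ~ L z -> psi z * f z = 0 by move=> /psi0 ->; rewrite mul0r.
have [cp hp0 Ip] := chart_divergence_theorem mu Cfp CX cL Ci fp0.
have [inp _] := integral_chart mu cp cL Ci hp0.
have Ep : divergence mu (scale_field (fun z => psi z * f z) X) =
    chart_div mu (chart_at A x) (scale_field (fun z => psi z * f z) X) \_ (chart_dom (chart_at A x)).
  apply/funext => z; rewrite patchE; case: ifPn => [/set_mem iz|/negP nz].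
    by apply: divergenceE => //; exact: scale_field_C1.
  apply: chart_div_scale_near0; first exact: chart_atP.
  apply: (near_off_compact A cL fp0) => /Ci iz; apply: nz; exact/mem_set.
rewrite -Ep in Ip inp.
have [inq Iq] : mu.-integrable [set: borel M]
      (EFin \o divergence mu (scale_field (fun z => (1 - psi z) * f z) X)) /\
    \int[mu]_(x in [set: borel M]) divergence mu (scale_field (fun z => (1 - psi z) * f z) X) x = 0.
  apply: IH => // z fz.
  have /fs[w] : f z != 0 by apply: contraNneq fz => ->; rewrite mulr0.
  (* On the plateau at [x] the factor [1 - psi] is 0, so the shorter list still covers. *)
  rewrite inE => /predU1P[->|ws] Vw; last by exists w.
  case/negP: fz; rewrite pE /= in Vw.
  by rewrite psi1 ?subrr ?mul0r//; exact: interior_subset Vw.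
have E : divergence mu (scale_field f X) =
    divergence mu (scale_field (fun z => psi z * f z) X) \+
    divergence mu (scale_field (fun z => (1 - psi z) * f z) X).
  apply/funext => z /=; rewrite -divergence_scaleD//.
  congr (divergence mu (scale_field _ X) z); apply/funext => w; ring.
rewrite E; split.
  exact: (integrableD measurableT inp inq).
by rewrite RintegralD// Ip Iq addr0.
Qed.

End divergence_theorem.

(** * Gradients *)

Section gradient.
Context (R : realType) (n : nat) (M : ptopologicalType) (A : smooth_atlas R n M)
  (g : riemannian_metric A).
Implicit Types (i j : chart_index A) (f h : M -> R) (x : M) (y : 'rV[R]_n) (X : vector_field A).

Lemma gmx_unit i y : chart_im i y -> g i y \in unitmx.
Proof.
move=> iy; rewrite -row_free_unit -kermx_eq0; apply: contraT => /rowV0Pn[v /sub_kermxP vg v0].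
by have := gmx_pos g iy v0; rewrite vg mul0mx mxE ltxx.
Qed.

Lemma gmx_C1 i y k l : chart_im i y -> C1_at (fun z => g i z k l) y.
Proof.
move=> iy; apply: (@smooth_on_mx_C1 _ _ (chart_im i)) => //; first exact: chart_im_open.
exact: gmx_smooth.
Qed.

Lemma gmx_inv_C1 i y k l : chart_im i y -> C1_at (fun z => invmx (g i z) k l) y.
Proof.
move=> iy; apply: C1_invmx => [k' l'|]; first exact: gmx_C1.
by apply: filterS (near_chart_im iy) => z; exact: gmx_unit.
Qed.

Lemma gmx_inv_sym i y k l : chart_im i y -> invmx (g i y) k l = invmx (g i y) l k.
Proof. by move=> iy; rewrite -[in RHS](gmx_sym g iy) -trmx_inv mxE. Qed.

Lemma gradE f i y k :
  grad g f i y 0 k = \sum_(l < n) partial l (f \o chart_inv i) y * invmx (g i y) l k.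
Proof. by rewrite mxE; apply: eq_bigr => l _; rewrite mxE. Qed.

(** The defining property of the gradient: the inverse matrix in [grad] cancels against the metric.
    Invariance of the gradient is derived from it. *)
Lemma grad_gmx f i y (w : 'rV[R]_n) : C1_on_charts A f -> chart_im i y ->
  (grad g f i y *m g i y *m w^T) 0 0 = 'd (f \o chart_inv i) y w.
Proof.
move=> Cf iy; rewrite /grad mulmxKV ?gmx_unit// -sum_partial; last exact/C1_differentiable/Cf.
by rewrite mxE; apply: eq_bigr => k _; rewrite !mxE.
Qed.

(** Invertibility of the Jacobian comes from the metric: by [gmx_compat], a vector killed by the
    differential would have length 0 in chart [i]. *)
Lemma diff_transition_mx i j y : chart_overlap i j y -> exists2 T : 'M[R]_n,
  T \in unitmx & forall v, 'd (chart_map j \o chart_inv i) y v = v *m T.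
Proof.
move=> oy; have [iy _] := (chart_overlapP i j y).1 oy.
pose T := lin1_mx ('d (chart_map j \o chart_inv i) y).
have dE v : 'd (chart_map j \o chart_inv i) y v = v *m T by rewrite mul_rV_lin1.
exists T => //; rewrite -row_free_unit -kermx_eq0.
apply: contraT => /rowV0Pn[v /sub_kermxP vT v0].
have := gmx_pos g iy v0.
by rewrite (gmx_compat g oy v v) dE vT !mul0mx mxE ltxx.
Qed.

Lemma grad_C1_field f : C1_on_charts A f ->
  (forall i k y, chart_im i y -> C1_at (partial k (f \o chart_inv i)) y) ->
  C1_field (grad g f).
Proof.
move=> Cf Cpf; split=> [i k y iy|i j y oy].
  under eq_fun do rewrite gradE.
  by apply: C1_sum => l _; apply: C1M; [exact: Cpf|exact: gmx_inv_C1].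
have [iy jy] := (chart_overlapP i j y).1 oy.
have [T uT dE] := diff_transition_mx oy.
have jm := chart_im_map jy; set y' := chart_map j (chart_inv i y) in jm *.
rewrite dE; apply/eqP; rewrite -subr_eq0; apply/eqP.
(* [p] is the defect in the transformation law. Its metric pairing with a transported vector
   [w *m T] is the differential of [f] on [w] computed in chart [j] minus the same in chart [i],
   hence 0. *)
set p := _ - _.
suff p0 : p *m (g j y' *m T^T) = 0.
  have uB : g j y' *m T^T \in unitmx by rewrite unitmx_mul gmx_unit// unitmx_tr.
  by rewrite -[p](mulmxK uB) p0 mul0mx.
have pw (w : 'rV[R]_n) : (p *m (g j y' *m T^T) *m w^T) 0 0 = 0.
  have -> : p *m (g j y' *m T^T) *m w^T =
      grad g f j y' *m g j y' *m (w *m T)^T - grad g f i y *m T *m g j y' *m (w *m T)^T.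
    by rewrite trmx_mul /p !mulmxBl !mulmxA.
  have mxB (a b : 'M[R]_1) : (a - b) 0 0 = a 0 0 - b 0 0 by rewrite !mxE.
  rewrite mxB grad_gmx//.
  have <- : grad g f i y *m g i y *m w^T = grad g f i y *m T *m g j y' *m (w *m T)^T.
    by rewrite -(dE w) -(dE (grad g f i y)); exact: gmx_compat.
  rewrite grad_gmx//; apply/eqP; rewrite subr_eq0; apply/eqP.
  by apply: etrans (esym (diff_transition Cf oy w)); rewrite -(dE w).
apply/rowP => k; have := pw (delta_mx 0 k).
by rewrite trmx_delta -colE mxE => ->; rewrite mxE.
Qed.

Lemma inner_grad f X x : C1_on_charts A f ->
  inner g (grad g f) X x = field_derive X (chart_at A x) f (chart_map (chart_at A x) x).
Proof.
move=> Cf; have iy := chart_im_map (chart_atP A x).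
by rewrite /inner grad_gmx// /field_derive sum_partial//; exact/C1_differentiable/Cf.
Qed.

End gradient.

(** * Divergence theorem under vanishing flux at infinity *)

Section vanishing_flux.
Context (R : realType) (n : nat) (M : ptopologicalType) (A : smooth_atlas R n M)
  (g : riemannian_metric A) (mu : volume_form A).
Implicit Types (f h : M -> R) (x : M) (X : vector_field A).

(** The field [chi k f X] has compact support, so the Leibniz rule turns the integral of [chi k * D]
    into minus the flux term, which tends to 0; dominated convergence, with the absolute value of
    [D] as bound, identifies the limit. *)
Lemma divergence_theorem_cutoff f X (chi : nat -> M -> R) : C1_on_charts A f -> C1_field X ->
  mu.-integrable [set: borel M] (EFin \o divergence mu (scale_field f X)) ->
  (forall k, cutoff A (chi k)) -> (forall x, chi k x @[k --> \oo] --> (1 : R)) ->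
  \int[mu]_(x in [set: borel M]) inner g (grad g (chi k)) (scale_field f X) x
    @[k --> \oo] --> (0 : R) ->
  \int[mu]_(x in [set: borel M]) divergence mu (scale_field f X) x = 0.
Proof.
move=> Cf CX iD cchi chi1 flux; set D := divergence mu (scale_field f X) in iD *.
have CfX : C1_field (scale_field f X : vector_field A) by exact: scale_field_C1.
have Cchi k : C1_on_charts A (chi k) by apply: smooth_C1_on_charts; have [] := cchi k.
have mD : measurable_fun [set: borel M] D.
  by apply: continuous_borel_measurable; exact: divergence_continuous.
have mchi k : measurable_fun [set: borel M] (chi k).
  by apply: continuous_borel_measurable; exact: C1_on_charts_continuous (Cchi k).
have chile k x : `|chi k x| <= 1.
  by have [_ /(_ x)/andP[c0 c1] _] := cchi k; rewrite ger0_norm.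
have ichi k : mu.-integrable [set: borel M] (EFin \o (fun x => chi k x * D x)).
  apply: le_integrable iD => //.
    by apply/measurable_EFinP; exact: measurable_funM.
  by move=> x _; rewrite lee_fin /= normrM ler_piMl.
have fluxE k : \int[mu]_(x in [set: borel M]) inner g (grad g (chi k)) (scale_field f X) x =
    - \int[mu]_(x in [set: borel M]) (chi k x * D x).
  have [_ _ [K cK K0]] := cchi k.
  have Cp : C1_on_charts A (fun x => chi k x * f x) := C1_on_chartsM (Cchi k) Cf.
  have p0 x : ~ K x -> chi k x * f x = 0 by move=> /K0 ->; rewrite mul0r.
  have [ip Ip] := divergence_theorem mu Cp CX cK p0.
  have E x : inner g (grad g (chi k)) (scale_field f X) x =
      divergence mu (scale_field (fun x => chi k x * f x) X) x - chi k x * D x.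
    have -> : scale_field (fun x => chi k x * f x) X = scale_field (chi k) (scale_field f X).
      by apply/funext => i; apply/funext => y; rewrite /scale_field scalerA.
    rewrite (divergence_scale mu x (Cchi k) CfX) (inner_grad _ _ _ (Cchi k)).
    by rewrite [X in X - _]addrC addrK.
  by under eq_Rintegral => x _ do rewrite E; rewrite RintegralB// Ip sub0r.
have lim0 : \int[mu]_(x in [set: borel M]) (chi k x * D x) @[k --> \oo] --> (0 : R).
  under eq_fun => k do rewrite -[\int[mu]_(x in _) _]opprK -fluxE.
  by rewrite -oppr0; exact: cvgN.
have [|||||_ _ limD] := @dominated_convergence _ _ R mu setT measurableT
  (fun k x => (chi k x * D x)%:E) (EFin \o D) (EFin \o (fun x => `|D x|)).
- by move=> k; apply/measurable_EFinP; exact: measurable_funM.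
- exact/measurable_EFinP.
- apply/aeW => x _; apply: cvg_EFin; first exact: nearW.
  by rewrite -[X in _ --> X]mul1r; apply: cvgMl; exact: chi1.
- by have := integrable_abse iD.
- by apply/aeW => x k _; rewrite lee_fin normrM ler_piMl.
have : \int[mu]_(x in [set: borel M]) (chi k x * D x) @[k --> \oo] -->
    \int[mu]_(x in [set: borel M]) D x.
  by apply: fine_cvg; rewrite fineK//; exact: integrable_fin_num.
by move=> /cvg_lim <- //; exact: cvg_lim.
Qed.

End vanishing_flux.

(** * Time-dependent functions and the time derivative of the squared gradient *)

Section curves.
Context (R : realType) (n : nat) (M : ptopologicalType) (A : smooth_atlas R n M).
Implicit Types (i : chart_index A) (x : M) (y : 'rV[R]_n) (u v : R -> M -> R) (J : set R).

Definition curve_in_chart i u (z : R * 'rV[R]_n) : R := u z.1 (chart_inv i z.2).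

Definition C1_curve J u := forall i t y, J t -> chart_im i y ->
  C1_at (curve_in_chart i u : (R^o * 'rV[R]_n)%type -> R) (t, y).

Lemma near_curve_domain J i t y : open J -> J t -> chart_im i y ->
  \forall z \near (t, y), J z.1 /\ chart_im i z.2.
Proof.
move=> oJ Jt iy; exists (J, chart_im i) => //; split => /=; last exact: near_chart_im.
exact: open_nbhs_nbhs.
Qed.

Lemma open_curve_domain J i : open J -> open (J `*` chart_im i : set (R^o * 'rV[R]_n)%type).
Proof.
by move=> oJ; rewrite openE => -[t y] [/= Jt iy]; exact: near_curve_domain.
Qed.

Lemma smooth_curve_C1 J u : open J -> smooth_curve A J u -> C1_curve J u.
Proof.
move=> oJ su i t y Jt iy; apply: smooth_on_C1 (su i) _; last by split.
exact: open_curve_domain.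
Qed.

Lemma C1_curve_slice J u t : C1_curve J u -> J t -> C1_on_charts A (u t).
Proof. by move=> Cu Jt i y iy; exact: (C1_slice (Cu i t y Jt iy)). Qed.

Lemma C1_curveM J u v : C1_curve J u -> C1_curve J v ->
  C1_curve J (fun t x => u t x * v t x).
Proof. by move=> Cu Cv i t y Jt iy; exact: (C1M (Cu i t y Jt iy) (Cv i t y Jt iy)). Qed.

Lemma curve_derive_chart u i t x : chart_dom i x ->
  (derivable (u^~ x) t 1 <->
     derivable (curve_in_chart i u : (R^o * 'rV[R]_n)%type -> R) (t, chart_map i x) (1, 0)) /\
  derive1 (u^~ x) t =
    'D_(1, 0) (curve_in_chart i u : (R^o * 'rV[R]_n)%type -> R) (t, chart_map i x).
Proof.
move=> ix; rewrite derive1E; apply: derive_along => h.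
have -> : h *: ((1, 0) : (R^o * 'rV[R]_n)%type) + (t, chart_map i x) =
  (h *: (1 : R) + t, h *: 0 + chart_map i x) by [].
by rewrite /curve_in_chart /= scaler0 add0r chart_mapK.
Qed.

Lemma C1_curve_derivable J u t x : C1_curve J u -> J t -> derivable (u^~ x) t 1.
Proof.
move=> Cu Jt; have ix := chart_atP A x.
apply: (iffRL (curve_derive_chart u t ix).1); apply: C1_derivable.
by apply: Cu => //; exact: chart_im_map.
Qed.

(** Continuity jointly in time and space is what a bound uniform in nearby times on a compact
    manifold requires. *)
Lemma C1_curve_derive_continuous J u t x : open J -> C1_curve J u -> J t ->
  {for (t, x), continuous (fun z : R * M => derive1 (u^~ z.2) z.1)}.
Proof.
move=> oJ Cu Jt; have ix := chart_atP A x; set i := chart_at A x in ix.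
pose F (z : (R^o * 'rV[R]_n)%type) := 'D_(1, 0) (curve_in_chart i u : (R^o * 'rV[R]_n)%type -> R) z.
apply: (@near_eq_continuous _ _ (F \o (fun z : R * M => (z.1, chart_map i z.2)))).
  exists (setT, chart_dom i); first by split; [exact: filterT|exact: near_chart_dom].
  by move=> [s z] [/= _ iz]; rewrite (curve_derive_chart u s iz).2.
apply: continuous_comp; last by have [_] := Cu i t _ Jt (chart_im_map ix); exact.
move=> P [[P1 P2] /= [p1 p2] hP]; exists (P1, chart_map i @^-1` P2).
  by split => //=; exact: near_chart_map.
by move=> [s z] [/= ? ?]; apply: hP.
Qed.

Lemma C1_curve_derive_slice_continuous J u t : open J -> C1_curve J u -> J t ->
  continuous (fun x => derive1 (u^~ x) t).
Proof.
move=> oJ Cu Jt x.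
apply: (@continuous_comp _ _ _ (fun x : M => (t, x)) (fun z : R * M => derive1 (u^~ z.2) z.1)).
  move=> P [[P1 P2] /= [p1 p2] hP]; apply: filterS p2 => z p2z.
  by apply: hP; split => //=; exact: nbhs_singleton p1.
by have := @C1_curve_derive_continuous J u t x oJ Cu Jt.
Qed.

Section smooth_curve_gradient.
Variables (g : riemannian_metric A) (J : set R) (theta : R -> M -> R).
Hypotheses (oJ : open J) (stheta : smooth_curve A J theta).

Let Ctheta := smooth_curve_C1 oJ stheta.

Lemma partial_curveE i k (z : (R^o * 'rV[R]_n)%type) :
  partial k (theta z.1 \o chart_inv i) z.2 =
  'D_(0, delta_mx 0 k) (curve_in_chart i theta : (R^o * 'rV[R]_n)%type -> R) z.
Proof.
case: z => t y; apply: (derive_along _).2 => h.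
have -> : h *: ((0, delta_mx 0 k) : (R^o * 'rV[R]_n)%type) + (t, y) =
  (h *: 0 + t, h *: delta_mx 0 k + y) by [].
by rewrite scaler0 add0r.
Qed.

Lemma partial_curve_C1 i k t y : J t -> chart_im i y ->
  C1_at (fun z : (R^o * 'rV[R]_n)%type => partial k (theta z.1 \o chart_inv i) z.2) (t, y).
Proof.
move=> Jt iy; rewrite (_ : (fun z => _) =
    'D_(0, delta_mx 0 k) (curve_in_chart i theta : (R^o * 'rV[R]_n)%type -> R)); last first.
  by apply/funext => z; exact: partial_curveE.
apply: (smooth_on_C1 (open_curve_domain oJ)); last by split; [exact: Jt|exact: iy].
exact/smooth_on_derive/stheta.
Qed.

Lemma grad_curve_C1_field t : J t -> C1_field (grad g (theta t)).
Proof.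
move=> Jt; apply: grad_C1_field; first exact: C1_curve_slice Ctheta Jt.
by move=> i k y iy; exact: (C1_slice (partial_curve_C1 k Jt iy)).
Qed.

Lemma grad_sq_curveE t i x : J t -> chart_dom i x -> grad_sq g (theta t) x =
  field_derive (grad g (theta t)) i (theta t) (chart_map i x).
Proof.
move=> Jt ix; have Ct := C1_curve_slice Ctheta Jt.
rewrite /grad_sq inner_grad//.
by apply: field_derive_chart => //; [exact: grad_curve_C1_field|exact: chart_atP].
Qed.

(** [grad_sq] reads each point in its own chart; chart independence rewrites it near [(t, y)] as a
    quadratic form in the partial derivatives of [theta] in one chart, with the time-independent
    inverse metric as coefficients. *)
Lemma grad_sq_curve_C1 : C1_curve J (fun t => grad_sq g (theta t)).
Proof.
move=> i t y Jt iy.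
apply: (@C1_near_eq _ _ (fun z : (R^o * 'rV[R]_n)%type => \sum_(k < n) partial k (theta z.1 \o chart_inv i) z.2 *
   \sum_(l < n) partial l (theta z.1 \o chart_inv i) z.2 * invmx (g i z.2) l k)).
  apply: filterS (near_curve_domain oJ Jt iy) => -[s z] [/= Js iz].
  rewrite /curve_in_chart /= (grad_sq_curveE Js (chart_im_dom iz)) chart_invK//.
  by apply: eq_bigr => k _; rewrite gradE.
apply: C1_sum => k _; apply: C1M; first exact: partial_curve_C1.
apply: C1_sum => l _; apply: C1M; first exact: partial_curve_C1.
apply: (@C1_snd _ _ _ (fun w => invmx (g i w) l k)); exact: gmx_inv_C1.
Qed.

Lemma partial_curve_derive i k t x : J t -> chart_dom i x ->
  is_derive t 1 (fun s => partial k (theta s \o chart_inv i) (chart_map i x))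
    (partial k ((fun x => derive1 (theta^~ x) t) \o chart_inv i) (chart_map i x)).
Proof.
move=> Jt ix; have iy := chart_im_map ix.
set U := (curve_in_chart i theta : (R^o * 'rV[R]_n)%type -> R).
have [d1 d2] : (derivable (fun s : R => partial k (theta s \o chart_inv i) (chart_map i x)) t 1 <->
    derivable ('D_(0, delta_mx 0 k) U) (t, chart_map i x) (1, 0)) /\
   'D_1 (fun s : R => partial k (theta s \o chart_inv i) (chart_map i x)) t =
    'D_(1, 0) ('D_(0, delta_mx 0 k) U) (t, chart_map i x).
  apply: derive_along => h.
  have -> : h *: ((1, 0) : (R^o * 'rV[R]_n)%type) + (t, chart_map i x) =
    (h *: (1 : R) + t, h *: 0 + chart_map i x) by [].
  by rewrite scaler0 add0r -partial_curveE.
have CD (w : (R^o * 'rV[R]_n)%type) : C1_at ('D_w U) (t, chart_map i x).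
  apply: (smooth_on_C1 (open_curve_domain oJ)); last by split; [exact: Jt|exact: iy].
  exact/smooth_on_derive/stheta.
split; first by apply/d1/C1_derivable/CD.
apply: etrans d2 _; rewrite schwarz; [|exact: Ctheta|exact: CD|exact: CD].
have [_ E] : (derivable ('D_(1, 0) U) (t, chart_map i x) (0, delta_mx 0 k) <->
     derivable (fun y => 'D_(1, 0) U (t, y)) (chart_map i x) (delta_mx 0 k)) /\
   'D_(0, delta_mx 0 k) ('D_(1, 0) U) (t, chart_map i x) =
   'D_(delta_mx 0 k) (fun y => 'D_(1, 0) U (t, y)) (chart_map i x).
  apply: derive_along => h.
  have -> : h *: ((0, delta_mx 0 k) : (R^o * 'rV[R]_n)%type) + (t, chart_map i x) =
    (h *: 0 + t, h *: delta_mx 0 k + chart_map i x) by [].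
  by rewrite scaler0 add0r.
rewrite E /partial; apply: near_eq_derive.
apply: filterS (near_chart_im iy) => z iz /=.
by rewrite (curve_derive_chart theta t (chart_im_dom iz)).2 chart_invK.
Qed.

Lemma grad_sq_curve_derive t x : J t ->
  derive1 (fun s => grad_sq g (theta s) x) t =
  2 * field_derive (grad g (theta t)) (chart_at A x) (fun x => derive1 (theta^~ x) t)
        (chart_map (chart_at A x) x).
Proof.
move=> Jt; have ix := chart_atP A x; set i := chart_at A x in ix *.
set y := chart_map i x; have iy : chart_im i y by exact: chart_im_map.
pose a k s := partial k (theta s \o chart_inv i) y.
pose b k := partial k ((fun x => derive1 (theta^~ x) t) \o chart_inv i) y.
have da k : is_derive t 1 (a k) (b k) by exact: partial_curve_derive.
pose G l k := invmx (g i y) l k.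
have E : {near t, (\sum_(k < n) a k * \sum_(l < n) (fun s => a l s * G l k)) =1 (fun s => grad_sq g (theta s) x)}.
  apply: filterS (open_nbhs_nbhs (conj oJ Jt)) => s Js.
  rewrite (grad_sq_curveE Js ix) fct_sumE; apply: eq_bigr => k _.
  by rewrite /= !fctE fct_sumE gradE.
have dsum : is_derive t 1 (\sum_(k < n) a k * \sum_(l < n) (fun s => a l s * G l k))
   (\sum_(k < n) (a k t * (\sum_(l < n) b l * G l k) + (\sum_(l < n) a l t * G l k) * b k)).
  have dk k : is_derive t 1 (\sum_(l < n) (fun s => a l s * G l k)) (\sum_(l < n) b l * G l k).
    apply: is_derive_sum => l; apply: (@is_derive_eq _ _ _ _ _ _ _ _ (is_deriveM (da l) (is_derive_cst (G l k) t 1))).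
    by rewrite scaler0 add0r /GRing.scale /= mulrC.
  apply: is_derive_sum => k; apply: (@is_derive_eq _ _ _ _ _ _ _ _ (is_deriveM (da k) (dk k))).
  by rewrite fct_sumE.
rewrite derive1E; have [_ ->] := near_eq_is_derive E dsum.
rewrite /field_derive big_split /= -/y.
(* Symmetry of the inverse metric makes the two halves of the product rule equal, whence the factor
   2. *)
have -> : \sum_(k < n) a k t * (\sum_(l < n) b l * G l k) =
   \sum_(k < n) (\sum_(l < n) a l t * G l k) * b k.
  under eq_bigr do rewrite mulr_sumr; rewrite exchange_big /=; apply: eq_bigr => k _.
  rewrite mulr_suml; apply: eq_bigr => l _.
  by rewrite /G (gmx_inv_sym g _ _ iy); ring.
have dbl (c d : R) : c = d -> c + c = 2 * d by move=> ->; rewrite mulr_natl mulr2n.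
apply: dbl; apply: eq_bigr => k _.
by rewrite gradE mulrC.
Qed.

End smooth_curve_gradient.
End curves.

(** * Balance laws *)

Section balance.
Context (R : realType) (n : nat) (M : ptopologicalType) (A : smooth_atlas R n M)
  (g : riemannian_metric A) (mu : volume_form A).
Variables (J : set R) (theta : R -> M -> R).
Hypotheses (oJ : open J) (stheta : smooth_curve A J theta).
Implicit Types (u : R -> M -> R) (t : R).

(** Differentiation under the integral, dominated by the [G] of [tame_density], leaves the integral
    of the divergence, which the cutoffs show to be 0. *)
Lemma balance_law u (w : M -> R) t : C1_curve A J u -> tame_density g mu J theta u ->
  J t -> mu.-integrable [set: borel M] (EFin \o w) ->
  (forall x, derive1 (u^~ x) t =
     - divergence mu (scale_field (u t) (grad g (theta t))) x + w x) ->
  is_derive t 1 (fun s => \int[mu]_(x in [set: borel M]) u s x)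
    (\int[mu]_(x in [set: borel M]) w x).
Proof.
move=> Cu tame Jt iw uE.
have [_ [G iG hG] [chi [cchi chi1 flux]]] := tame t Jt.
have Cut : C1_on_charts A (u t) by exact: C1_curve_slice Cu Jt.
have CX : C1_field (grad g (theta t)) by exact: (grad_curve_C1_field g oJ stheta Jt).
set D := divergence mu (scale_field (u t) (grad g (theta t))) in uE.
have mdu : measurable_fun [set: borel M] (fun x => derive1 (u^~ x) t).
  by apply: continuous_borel_measurable; exact: C1_curve_derive_slice_continuous Cu Jt.
have idu : mu.-integrable [set: borel M] (EFin \o (fun x => derive1 (u^~ x) t)).
  apply: le_integrable iG => //; first exact/measurable_EFinP.
  move=> x _; rewrite lee_fin (le_trans (nbhs_singleton hG x))// ler_norm//.
(* Integrability of the divergence is read off the equation: it is [w] minus the time derivative,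
   both integrable. *)
have iD : mu.-integrable [set: borel M] (EFin \o D).
  have -> : (EFin \o D = (EFin \o w) \- (EFin \o (fun x => derive1 (u^~ x) t)))%E.
    by apply/funext => x; rewrite /= -EFinB uE opprD opprK addrCA subrr addr0.
  exact: integrableB.
have ID : \int[mu]_(x in [set: borel M]) D x = 0.
  exact: divergence_theorem_cutoff Cut CX iD cchi chi1 flux.
have [r /= r0 hr] : \forall s \near t, J s /\ forall x, `|derive1 (u^~ x) s| <= G x.
  by apply: filterS2 (open_nbhs_nbhs (conj oJ Jt)) hG.
have Ir s : `]t - r, t + r[%classic s -> J s /\ forall x, `|derive1 (u^~ x) s| <= G x.
  rewrite /= in_itv /= => /andP[h1 h2]; apply: hr.
  by rewrite /ball_ /= ltr_norml; apply/andP; split; lra.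
have tr : `]t - r, t + r[%classic t.
  by rewrite /= in_itv /=; apply/andP; split; lra.
have G0 x : 0 <= G x by exact: le_trans (nbhs_singleton hG x).
have iu s : `]t - r, t + r[%classic s -> mu.-integrable [set: borel M] (EFin \o u s).
  by move=> /Ir[Js _]; have [] := tame s Js.
have du s (x : borel M) : `]t - r, t + r[%classic s -> [set: borel M] x -> derivable (u^~ x) s 1.
  by move=> /Ir[Js _] _; exact: C1_curve_derivable Cu Js.
have uG s (x : borel M) : `]t - r, t + r[%classic s -> [set: borel M] x -> `|derive1 (u^~ x) s| <= G x.
  by move=> /Ir[_ h] _.
split.
  exact: (derivable_under_integral measurableT tr iu du G0 iG uG).
rewrite -derive1E (differentiation_under_integral measurableT tr iu du G0 iG uG).
under eq_Rintegral => x _ do rewrite [partial1of2 _ _ _]uE addrC.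
by rewrite RintegralB// ID subr0.
Qed.

Hypothesis mu1 : mu [set: borel M] = 1%E.

Lemma integrable_cst_vol (c : R) : mu.-integrable [set: borel M] (EFin \o (fun=> c)).
Proof.
apply/integrableP; split; first exact: measurable_cst.
by rewrite integral_cst//= mu1 mule1 ltry.
Qed.

(** Continuity replaces decay: constants are integrable since [mu] has finite mass, and cutoffs
    constantly 1 have zero gradient, hence zero flux. *)
Lemma compact_tame u : compact [set: M] -> C1_curve A J u -> tame_density g mu J theta u.
Proof.
move=> cM Cu t Jt.
have Cut : C1_on_charts A (u t) by exact: C1_curve_slice Cu Jt.
have cut := C1_on_charts_continuous Cut.
split.
- have /compact_bounded[S0 [_ hS]] : compact (u t @` [set: M]).
    by apply: continuous_compact => //; exact: continuous_subspaceT.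
  apply: (@le_integrable _ _ _ _ _ _ _ _ _ _ (integrable_cst_vol (S0 + 1))) => //.
    by apply/measurable_EFinP; exact: continuous_borel_measurable.
  move=> x _; rewrite lee_fin (le_trans _ (ler_norm _))// .
  by apply: (hS (S0 + 1)); [rewrite ltrDl|exists x].
(* A bound for all [x] and all times near [t] at once: the bound is treated as a second parameter
   tending to infinity, and compactness makes the local estimates uniform in [x]. *)
- have : \forall z \near filter_prod (nbhs t) (pinfty_nbhs R),
      forall x, [set: M] x -> `|derive1 (u^~ x) z.1| <= z.2.
    apply: ((compact_near_coveringP _).1 cM) => x _.
    have cx := @C1_curve_derive_continuous _ _ _ _ J u t x oJ Cu Jt.
    have c1 : \forall z \near (t, x), `|derive1 (u^~ z.2) z.1| < `|derive1 (u^~ x) t| + 1.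
      have : {for (t, x), continuous (fun z : R * M => `|derive1 (u^~ z.2) z.1|)}.
        by apply: continuous_comp cx _; exact: norm_continuous.
      have : `|derive1 (u^~ x) t| < `|derive1 (u^~ x) t| + 1 by rewrite ltrDl.
      by move=> /lt_nbhsl h c; exact: (c _ h).
    case: c1 => -[P Q] /= [Pt Qx] PQ.
    exists (Q, P `*` [set C | `|derive1 (u^~ x) t| + 1 <= C]).
      split => //=; exists (P, [set C | `|derive1 (u^~ x) t| + 1 <= C]) => //.
      by split => //=; exact: nbhs_pinfty_ge.
    move=> [z [s C]] [/= Qz [Ps hC]]; apply: le_trans hC.
    by apply: ltW; apply: (PQ (s, z)).
  move=> [[P Q] /= [Pt [C0 [_ hC0]]] PQ].
  exists (fun=> C0 + 1); first exact: integrable_cst_vol.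
  apply: filterS Pt => s Ps x; apply: (PQ (s, C0 + 1)) => //.
  by split => //=; apply: hC0; rewrite ltrDl.
- exists (fun _ => cst 1); split.
  + move=> _; split; last 2 first.
    * by move=> x; rewrite ler01 lexx.
    * by exists setT => // x nx; case: (nx I).
    move=> i k; rewrite (_ : _ \o _ = cst 1)//.
    have cst_Ck (V W : normedModType R) (D : set V) (a : W) : Ck_on k D (cst a).
      elim: k a => [|k IH] a /=; first by move=> x _; exact: cst_continuous.
      split=> [x _|v]; first exact: differentiable_cst.
      rewrite (_ : 'D_v _ = cst 0); first exact: IH.
      by apply/funext => x; exact: derive_cst.
    exact: cst_Ck.
  + by move=> x; exact: cvg_cst.
  + have E x : inner g (grad g (cst 1)) (scale_field (u t) (grad g (theta t))) x = 0.
      rewrite inner_grad; last exact: C1_on_charts_cst.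
      rewrite /field_derive big1// => k _.
      by rewrite /partial [X in X * _](derive_cst (1 : R)) mul0r.
    rewrite (_ : (fun k : nat => _) = cst 0); first exact: cvg_cst.
    apply/funext => k; rewrite -[RHS](mul0r (fine (mu [set: borel M]))) -Rintegral_cst//.
    by apply: eq_Rintegral => x _; exact: E.
Qed.

(** A positive function with zero integral would vanish almost everywhere and make [M] a null set,
    against total mass 1. This justifies dividing by [m] in [xi]. *)
Lemma total_volume_neq0 rho : in_Vol mu rho -> total_volume mu rho != 0.
Proof.
move=> [_ rho0 irho]; apply: contraT; rewrite negbK => /eqP vol0.
have mrho : measurable_fun [set: borel M] (EFin \o rho) by case/integrableP: irho.
have : (\int[mu]_(x in [set: borel M]) `|(EFin \o rho) x| = 0)%E.
  under eq_integral => x _ do rewrite /= (gtr0_norm (rho0 x)).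
  by rewrite -(fineK (integrable_fin_num measurableT irho)); congr EFin.
move=> /(ae_eq_integral_abs mu measurableT mrho)[N [mN N0 sN]].
have : N = [set: borel M].
  apply/seteqP; split => // x _; apply: sN => /= /(_ I) [] h.
  by have := rho0 x; rewrite h ltxx.
by move=> NT; move: N0; rewrite NT mu1 => /eqP; rewrite onee_eq0.
Qed.

End balance.

(** * Evolution of volume, momentum and energy *)

Section geodesic_densities.
Context (R : realType) (n : nat) (M : ptopologicalType) (A : smooth_atlas R n M)
  (g : riemannian_metric A) (mu : volume_form A).

Lemma divergence_scaleM f h (X : vector_field A) x :
  C1_on_charts A f -> C1_on_charts A h -> C1_field X ->
  divergence mu (scale_field (fun z => h z * f z) X) x =
  h x * divergence mu (scale_field f X) x +
  f x * field_derive X (chart_at A x) h (chart_map (chart_at A x) x).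
Proof.
move=> Cf Ch CX.
have -> : scale_field (fun z => h z * f z) X = scale_field h (scale_field f X).
  by apply/funext => i; apply/funext => y; rewrite /scale_field scalerA.
rewrite divergence_scale//; last exact: scale_field_C1.
congr (_ + _); rewrite /field_derive mulr_sumr; apply: eq_bigr => k _.
by rewrite mxE (chart_mapK (chart_atP A x)) mulrCA.
Qed.

(** Shaped for the equation of [theta], whose right side combines [grad_sq], [theta] and a term
    constant in space. *)
Lemma field_derive_affine (a b c : R) f h (X : vector_field A) i y : chart_im i y ->
  C1_on_charts A f -> C1_on_charts A h ->
  field_derive X i (fun x => a * f x + b * h x + c) y =
  a * field_derive X i f y + b * field_derive X i h y.
Proof.
move=> iy Cf Ch; rewrite /field_derive !mulr_sumr -big_split; apply: eq_bigr => k _ /=.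
rewrite !mulrA -mulrDl; congr (_ * _).
have df := C1_derivable (v := delta_mx 0 k : 'rV[R]_n) (Cf i y iy).
have dh := C1_derivable (v := delta_mx 0 k : 'rV[R]_n) (Ch i y iy).
rewrite /partial (_ : _ \o chart_inv i =
  a *: (f \o chart_inv i) + b *: (h \o chart_inv i) + cst c)//.
have da := derivableZ (k := a) df; have db := derivableZ (k := b) dh.
apply: etrans (deriveD (derivableD da db) (derivable_cst c _ _)) _.
apply: etrans (congr2 +%R (deriveD da db) (derive_cst c _ _)) _; rewrite addr0.
exact: (congr2 +%R (deriveZ a df) (deriveZ b dh)).
Qed.

Variables (J : set R) (rho theta : R -> M -> R).
Hypotheses (oJ : open J) (mu1 : mu [set: borel M] = 1%E)
  (geo : geodesic g mu J rho theta).

Let srho : smooth_curve A J rho. Proof. by case: geo. Qed.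
Let stheta : smooth_curve A J theta. Proof. by case: geo. Qed.
Let Crho := smooth_curve_C1 oJ srho.
Let Ctheta := smooth_curve_C1 oJ stheta.
Let Q t := grad_sq g (theta t).
Let CQ : C1_curve A J Q := grad_sq_curve_C1 g oJ stheta.
Let x_ t := xi mu (rho t) (theta t).
Let X t := grad g (theta t).

(** The identity [theta div(rho X) + rho Q = div(theta rho X)] absorbs the transport term and
    releases [Q rho], of which the equation of [theta] takes back one half; the two terms in
    [xi theta rho] cancel. *)
Lemma geodesic_momentum_density t x : J t ->
  derive1 (fun s => theta s x * rho s x) t =
  - divergence mu (scale_field (fun z => theta t z * rho t z) (X t)) x +
  (2^-1 * (Q t x * rho t x) + x_ t ^+ 2 / 2 * rho t x).
Proof.
move=> Jt; have [_ _ _ Erho Etheta] := geo.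
have CX : C1_field (X t) := grad_curve_C1_field g oJ stheta Jt.
have Ct := C1_curve_slice Ctheta Jt; have Cr := C1_curve_slice Crho Jt.
rewrite derive1E (@deriveM _ _ (theta^~ x) (rho^~ x)); [|exact: C1_curve_derivable Ctheta Jt|exact: C1_curve_derivable Crho Jt].
rewrite -!derive1E Erho// Etheta// divergence_scaleM//.
rewrite -(grad_sq_curveE g oJ stheta Jt (chart_atP A x)) /GRing.scale /= -/(x_ t) -/(Q t x) -/(X t).
by move: (divergence _ _ x) (Q t x) (x_ t) (theta t x) (rho t x) => *; field.
Qed.

(** The time derivative of [Q] is [2 X(theta_t) = - X(Q) - 2 xi Q], since [X(theta) = Q] and the
    spatially constant term drops. The part [- X(Q) rho] completes the divergence, and [-2 xi + xi]
    leaves [- xi]. *)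
Lemma geodesic_kinetic_density t x : J t ->
  derive1 (fun s => Q s x * rho s x) t =
  - divergence mu (scale_field (fun z => Q t z * rho t z) (X t)) x +
  - x_ t * (Q t x * rho t x).
Proof.
move=> Jt; have [_ _ _ Erho Etheta] := geo.
have CX : C1_field (X t) := grad_curve_C1_field g oJ stheta Jt.
have Ct := C1_curve_slice Ctheta Jt; have Cr := C1_curve_slice Crho Jt.
have Cq := C1_curve_slice CQ Jt.
have iy := chart_im_map (chart_atP A x).
rewrite derive1E (@deriveM _ _ (Q^~ x) (rho^~ x)); [|exact: C1_curve_derivable CQ Jt|exact: C1_curve_derivable Crho Jt].
rewrite -!derive1E Erho// (grad_sq_curve_derive g oJ stheta)// divergence_scaleM//.
have -> : (fun z => derive1 (theta^~ z) t) =
    (fun z => - 2^-1 * Q t z + - x_ t * theta t z + x_ t ^+ 2 / 2).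
  by apply/funext => z; rewrite Etheta// [- x_ t * _]mulNr.
rewrite field_derive_affine//.
rewrite -(grad_sq_curveE g oJ stheta Jt (chart_atP A x)) /GRing.scale /= -/(x_ t) -/(Q t x) -/(X t).
by move: (divergence _ _ x) (field_derive _ _ _ _) (Q t x) (x_ t) (rho t x) => *; field.
Qed.

Hypothesis tame : decays_at_infinity g mu J rho theta.

Let m t := total_volume mu (rho t).
Let P t := \int[mu]_(x in [set: borel M]) (theta t x * rho t x).
Let K t := \int[mu]_(x in [set: borel M]) (Q t x * rho t x).
Let H t := hamiltonian g mu (rho t) (theta t).

Lemma geodesic_m_neq0 t : J t -> m t != 0.
Proof. by move=> Jt; apply: total_volume_neq0 => //; case: geo => _ _ + _ _; exact. Qed.

Let integrableZ c (f : M -> R) : mu.-integrable [set: borel M] (EFin \o f) ->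
  mu.-integrable [set: borel M] (EFin \o (fun x => c * f x)).
Proof. by move=> h; have := integrableZl measurableT c h. Qed.

Lemma geodesic_volume_derive t : J t -> is_derive t 1 m (P t).
Proof.
move=> Jt; have [tr _ _] := tame; have [ir _ _] := tr t Jt; have [_ _ _ Erho _] := geo.
have -> : P t = \int[mu]_(x in [set: borel M]) (x_ t * rho t x).
  by rewrite RintegralZl// /x_ /xi -/(P t) -/(m t) mulrAC mulVf ?mul1r// geodesic_m_neq0.
apply: (@balance_law _ _ _ _ g mu J theta oJ stheta rho (fun x => x_ t * rho t x) t Crho tr Jt).
  exact: integrableZ.
by move=> x; rewrite Erho.
Qed.

Lemma geodesic_momentum_derive t : J t -> is_derive t 1 P (H t).
Proof.
move=> Jt; have [tr tp tk] := tame; have [ir _ _] := tr t Jt; have [ik _ _] := tk t Jt.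
have m0 := geodesic_m_neq0 Jt.
(* As [xi = P / m], the term [xi^2 m / 2] equals [P^2 / (2 m)], the second part of the
   Hamiltonian. *)
have -> : H t = \int[mu]_(x in [set: borel M])
    (2^-1 * (Q t x * rho t x) + x_ t ^+ 2 / 2 * rho t x).
  rewrite RintegralD//; [|exact: integrableZ|exact: integrableZ].
  rewrite !RintegralZl// -/(K t) -/(m t) /H /hamiltonian -/(K t) -/(P t) -/(m t) /x_ /xi -/(P t) -/(m t).
  rewrite -[\int[mu]_(x in _) rho t x]/(m t).
  by move: (K t) (P t) (m t) m0 => k p v v0; field.
apply: (@balance_law _ _ _ _ g mu J theta oJ stheta (fun s x => theta s x * rho s x)
  (fun x => 2^-1 * (Q t x * rho t x) + x_ t ^+ 2 / 2 * rho t x) t (C1_curveM Ctheta Crho) tp Jt).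
- exact: (integrableD measurableT (integrableZ 2^-1 ik) (integrableZ (x_ t ^+ 2 / 2) ir)).
- by move=> x; exact: geodesic_momentum_density.
Qed.

Lemma geodesic_kinetic_derive t : J t -> is_derive t 1 K (- x_ t * K t).
Proof.
move=> Jt; have [tr tp tk] := tame; have [ik _ _] := tk t Jt.
rewrite -RintegralZl//.
apply: (@balance_law _ _ _ _ g mu J theta oJ stheta (fun s x => Q s x * rho s x)
  (fun x => - x_ t * (Q t x * rho t x)) t (C1_curveM CQ Crho) tk Jt).
- exact: integrableZ.
- by move=> x; exact: geodesic_kinetic_density.
Qed.

(** With [H = K/2 + P^2/(2m)] and [xi = P/m], the rules [m' = P], [P' = H], [K' = - xi K] give
    [H' = xi (H - K/2 - P^2/(2m)) = 0]. *)
Lemma geodesic_hamiltonian_derive t : J t -> is_derive t 1 H 0.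
Proof.
move=> Jt; have m0 := geodesic_m_neq0 Jt.
have dm := geodesic_volume_derive Jt; have dP := geodesic_momentum_derive Jt.
have dK := geodesic_kinetic_derive Jt.
have HE : H = fun s => 2^-1 * K s + 2^-1 * ((m s)^-1 * P s ^+ 2).
  by apply/funext => s; rewrite /H /hamiltonian -/(K s) -/(P s) -/(m s) invfM mulrA.
have Ht : H t = 2^-1 * K t + 2^-1 * ((m t)^-1 * P t ^+ 2) by rewrite HE.
rewrite {1}HE; apply: is_derive_eq.
rewrite Ht /x_ /xi -/(P t) -/(m t) /GRing.scale /=.
by move: (K t) (P t) (m t) m0 => k p v v0; field.
Qed.

Lemma geodesic_hamiltonian_cst s t : is_interval J -> J s -> J t -> H s = H t.
Proof.
move=> iJ; suff lt_cst a b : a < b -> J a -> J b -> H a = H b.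
  by move=> Js Jt; have [st|ts|->//] := ltgtP s t; [|apply/esym]; exact: lt_cst.
move=> ab Ja Jb; have sub c : a <= c <= b -> J c by exact: iJ Ja Jb c.
have [||c _ /eqP] := @MVT _ H (fun=> 0) a b ab.
- move=> c; rewrite in_itv /= => /andP[/ltW ac /ltW cb].
  by apply/geodesic_hamiltonian_derive/sub/andP.
- apply: derivable_within_continuous => c; rewrite in_itv /= => acb.
  by have [] := geodesic_hamiltonian_derive (sub c acb).
- by rewrite mul0r subr_eq0 => /eqP.
Qed.

End geodesic_densities.

Theorem corollary2p8 (R : realType) (n : nat) (M : ptopologicalType)
    (A : smooth_atlas R n M) (g : riemannian_metric A) (mu : volume_form A)
    (mu1 : mu [set: borel M] = 1%E) :
  exists acceleration : R -> R,
  forall (J : set R) (rho theta : R -> M -> R) (t0 : R),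
    open J -> is_interval J -> J t0 ->
    geodesic g mu J rho theta ->
    compact [set: M] \/ decays_at_infinity g mu J rho theta ->
    let m := fun t : R => total_volume mu (rho t) in
    forall t, J t ->
      [/\ derivable m t 1, derivable (derive1 m) t 1 &
          derive1 (derive1 m) t = acceleration (hamiltonian g mu (rho t0) (theta t0))].
Proof.
(* Chosen before the geodesic, so that the acceleration can depend on the solution through its
   energy alone. *)
exists id => J rho theta t0 oJ iJ Jt0 geo compact_or_tame m t Jt.
have [srho stheta _ _ _] := geo.
have Crho := smooth_curve_C1 oJ srho; have Ctheta := smooth_curve_C1 oJ stheta.
have tame : decays_at_infinity g mu J rho theta.
  case: compact_or_tame => [cM|//].
  have CQ := grad_sq_curve_C1 g oJ stheta.
  have ct u : C1_curve A J u -> tame_density g mu J theta u by exact: compact_tame.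
  by split; apply: ct; [exact: Crho|exact: (C1_curveM Ctheta Crho)|exact: (C1_curveM CQ Crho)].
have dm s (Js : J s) := geodesic_volume_derive oJ mu1 geo tame Js.
have dP := geodesic_momentum_derive oJ mu1 geo tame Jt.
have [derP valP] := dP.
(* A second derivative at [t] needs the first one on a neighbourhood of [t]; openness of [J]
   supplies it. *)
have E : {near t, (fun s => \int[mu]_(x in [set: borel M]) (theta s x * rho s x)) =1 derive1 m}.
  apply: filterS (open_nbhs_nbhs (conj oJ Jt)) => s Js.
  by rewrite derive1E; have [_ ->] := dm s Js.
split; first by have [] := dm t Jt.
  exact: near_eq_derivable E derP.
rewrite derive1E -(near_eq_derive _ E) valP.
exact: (geodesic_hamiltonian_cst oJ mu1 geo tame iJ Jt Jt0).
Qed.
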